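(* For all integers $n\ge 1$, we have $c_{n,n+2}=c_{n,n+1}=r_n$, where $r_n=\arccos\left(\frac{-1}{n+1}\right)$ and, for integers $k\ge n$, $c_{n,k}=\inf\{r\ge 0\mid \text{there exists an odd map } S^k\to \mathrm{VR}(S^n;r)\}$.
   Context: $S^n=\{x\in\mathbb{R}^{n+1}\mid \|x\|=1\}$ carries the geodesic metric $d_{S^n}(x,x')=\arccos\langle x,x'\rangle$, with involution $x\mapsto -x$. The number $r_n$ is the geodesic distance between two vertices of a regular $(n+1)$-simplex inscribed in $S^n$. A ''map'' is a continuous function. A map between spaces with involutions (both written $x\mapsto -x$) is odd if $f(-x)=-f(x)$ for all $x$. For a metric space $X$ and $r\ge 0$, the Vietoris--Rips complex $\mathrm{VR}(X;r)$ is the simplicial complex with vertex set $X$ whose simplices are the nonempty finite subsets $\sigma\subseteq X$ with $\operatorname{diam}(\sigma)\le r$; it is identified with its geometric realization. If $X$ has an isometric involution $x\mapsto -x$, then $\mathrm{VR}(X;r)$ has the involution $-\left(\sum_i\lambda_i x_i\right)=\sum_i\lambda_i(-x_i)$. *)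

(* Defs.v *)
From HB Require Import structures.
From mathcomp Require Import all_boot all_order all_algebra finmap.
From mathcomp Require Import ring lra.
From mathcomp Require Import all_classical all_reals all_analysis.

Set Implicit Arguments.
Unset Strict Implicit.
Unset Printing Implicit Defensive.

Import Order.TTheory GRing.Theory Num.Theory.
Import numFieldNormedType.Exports.

Local Open Scope classical_set_scope.
Local Open Scope fset_scope.
Local Open Scope ring_scope.

(* Abstract simplicial complexes on (a subset of) V. *)
Record simplicial_complex (V : choiceType) := SimplicialComplex {
  simplices : set {fset V};
  simplices_neq0 : forall s, simplices s -> s != fset0;
  simplices_face : forall s t,
    simplices s -> t `<=` s -> t != fset0 -> simplices t
}.

Section Realization.
Variables (R : realType) (V : choiceType) (K : simplicial_complex V).

(* A point is the function of its barycentric coordinates. *)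
Definition barycentric (w : {fsfun V -> R with 0}) : Prop :=
  [/\ simplices K (finsupp w), forall v, 0 <= w v & \sum_(v <- finsupp w) w v = 1].

Record realization := Realization {
  bary : {fsfun V -> R with 0};
  _ : `[< barycentric bary >]
}.

HB.instance Definition _ := [isSub for bary].
HB.instance Definition _ := [Choice of realization by <:].

(* The weak (coherent) topology: U is open iff its trace on each closed        *)
(* simplex {p | finsupp (bary p) `<=` s} is open for the Euclidean topology,   *)
(* which on the finitely many coordinates in s is that of the sup distance.    *)
Definition realization_open (U : set realization) : Prop :=
  forall s, simplices K s -> forall p, U p -> finsupp (bary p) `<=` s ->
  exists2 e : R, 0 < e & forall q, finsupp (bary q) `<=` s ->
    (forall v, `|bary p v - bary q v| < e) -> U q.

Let openT : realization_open setT.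
Proof. by move=> s _ p _ _; exists 1. Qed.

Let openI : setI_closed realization_open.
Proof.
move=> A B oA oB s Ks p [Ap Bp] ps.
have [e e0 eA] := oA s Ks p Ap ps; have [d d0 dB] := oB s Ks p Bp ps.
exists (Num.min e d); first by rewrite lt_min e0.
move=> q qs pq; split.
  by apply: eA => // v; apply: lt_le_trans (pq v) _; rewrite ge_min lexx.
by apply: dB => // v; apply: lt_le_trans (pq v) _; rewrite ge_min lexx orbT.
Qed.

Let open_bigU (I : Type) (f : I -> set realization) :
  (forall i, realization_open (f i)) -> realization_open (\bigcup_i f i).
Proof.
move=> of_ s Ks p [i _ fp] ps; have [e e0 ef] := of_ i s Ks p fp ps.
by exists e => // q qs pq; exists i => //; exact: ef.
Qed.

HB.instance Definition _ :=
  isOpenTopological.Build realization openT openI open_bigU.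

Lemma baryP (p : realization) : barycentric (bary p).
Proof. by case: p => w /= /asboolP. Qed.

End Realization.

Section VietorisRips.
Variables (R : realType) (X : metricType R).

Definition diam (A : set X) : R := sup [set mdist x y | x in A & y in A].

Lemma diam_fset_le (s : {fset X}) (r : R) : s != fset0 ->
  diam [set` s] <= r <-> (forall x y, x \in s -> y \in s -> mdist x y <= r).
Proof.
case/fset0Pn => z zs; split => [dr x y xs ys|xyr].
  apply: le_trans dr; apply: ub_le_sup; last by exists x => //; exists y.
  exists (\sum_(a <- s) \sum_(b <- s) mdist a b) => _ [a /= sa [b /= sb <-]].
  rewrite (big_fsetD1 a)//= (big_fsetD1 b)//= -addrA lerDl addr_ge0 ?sumr_ge0//.
    by move=> i _; rewrite mdist_ge0.
  by move=> i _; rewrite sumr_ge0// => j _; rewrite mdist_ge0.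
apply: ge_sup; first by exists (mdist z z), z => //; exists z.
by move=> _ [a /= sa [b /= sb <-]]; exact: xyr.
Qed.

Definition VR_simplex (r : R) : set {fset X} :=
  [set s | s != fset0 /\ diam [set` s] <= r].

Let VR_neq0 r s : VR_simplex r s -> s != fset0.
Proof. by case. Qed.

Let VR_face r s t : VR_simplex r s -> t `<=` s -> t != fset0 -> VR_simplex r t.
Proof.
move=> [s0 /(diam_fset_le _ s0) sr] /fsubsetP ts t0; split => //.
by apply/diam_fset_le => // x y /ts xs /ts ys; exact: sr.
Qed.

Definition VR_complex (r : R) : simplicial_complex X :=
  SimplicialComplex (@VR_neq0 r) (@VR_face r).

Definition VR (r : R) := realization R (VR_complex r).

HB.instance Definition _ r := Topological.on (VR r).

Variables (opp : X -> X) (oppK : involutive opp).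
Hypothesis opp_isometry : forall x y, mdist (opp x) (opp y) = mdist x y.

(* The coefficient of sum_i lambda_i (- x_i) at y is that of                   *)
(* sum_i lambda_i x_i at - y.                                                  *)
Definition opp_coord (w : {fsfun X -> R with 0}) : {fsfun X -> R with 0} :=
  [fsfun y in [fset opp x | x in finsupp w] => w (opp y) | 0].

Lemma opp_coordE w y : opp_coord w y = w (opp y).
Proof.
rewrite fsfunE; case: ifPn => // /imfsetP yw; apply/esym/fsfun_dflt.
by apply/negP => wy; apply: yw; exists (opp y) => //; rewrite oppK.
Qed.

Lemma finsupp_opp_coord w :
  finsupp (opp_coord w) = [fset opp x | x in finsupp w].
Proof.
apply/fsetP => y; rewrite mem_finsupp opp_coordE -mem_finsupp.
apply/idP/imfsetP => [wy|[x /= xw ->]]; last by rewrite oppK.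
by exists (opp y) => //; rewrite oppK.
Qed.

Let VR_opp_subproof r (p : VR r) :
  `[< barycentric (VR_complex r) (opp_coord (bary p)) >].
Proof.
apply/asboolP; have [[p0 pr] pge0 p1] := baryP p; split.
- rewrite finsupp_opp_coord; have q0 : [fset opp x | x in finsupp (bary p)]
      != fset0.
    by case/fset0Pn: p0 => x xp; apply/fset0Pn; exists (opp x); exact: in_imfset.
  split=> //; apply/diam_fset_le => // x y /imfsetP[a /= ap ->].
  by move=> /imfsetP[b /= bp ->]; rewrite opp_isometry; exact: (diam_fset_le r p0).1.
- by move=> v; rewrite opp_coordE.
- rewrite finsupp_opp_coord big_imfset/=; last first.
    by move=> x y _ _; exact: (inv_inj oppK).
  by rewrite -p1; apply: eq_bigr => x _; rewrite opp_coordE oppK.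
Qed.

Definition VR_opp r (p : VR r) : VR r := Realization (VR_opp_subproof p).

End VietorisRips.

Section Sphere.
Variables (R : realType) (n : nat).
Implicit Types x y z : 'rV[R]_n.+1.

Definition dot x y : R := \sum_i x 0 i * y 0 i.
Definition enorm x : R := Num.sqrt (dot x x).

(* S^n; note that the library norm on 'rV is the sup norm. *)
Record sphere := Sphere { svec :> 'rV[R]_n.+1; _ : enorm svec == 1 }.

HB.instance Definition _ := [isSub for svec].
HB.instance Definition _ := [Choice of sphere by <:].

Lemma dotC x y : dot x y = dot y x.
Proof. by apply: eq_bigr => i _; rewrite mulrC. Qed.

Lemma dotDl x y z : dot (x + y) z = dot x z + dot y z.
Proof. by rewrite -big_split; apply: eq_bigr => i _; rewrite mxE mulrDl. Qed.

Lemma dotZl a x y : dot (a *: x) y = a * dot x y.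
Proof. by rewrite mulr_sumr; apply: eq_bigr => i _; rewrite mxE mulrA. Qed.

Lemma dotNl x y : dot (- x) y = - dot x y.
Proof. by rewrite -scaleN1r dotZl mulN1r. Qed.

Lemma dotDr x y z : dot x (y + z) = dot x y + dot x z.
Proof. by rewrite dotC dotDl !(dotC x). Qed.

Lemma dotZr a x y : dot x (a *: y) = a * dot x y.
Proof. by rewrite dotC dotZl (dotC x). Qed.

Lemma dotNr x y : dot x (- y) = - dot x y.
Proof. by rewrite dotC dotNl (dotC x). Qed.

Lemma dot_ge0 x : 0 <= dot x x.
Proof. by apply: sumr_ge0 => i _; rewrite -expr2 sqr_ge0. Qed.

Lemma dot_eq0 x : dot x x = 0 -> x = 0.
Proof.
move/eqP; rewrite psumr_eq0 => [/allP x0|i _]; last by rewrite -expr2 sqr_ge0.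
apply/rowP => i; rewrite mxE; apply/eqP; rewrite -sqrf_eq0 expr2.
exact: (x0 i (mem_index_enum i)).
Qed.

Lemma svec_dot (x : sphere) : dot x x = 1.
Proof.
case: x => x /= /eqP; rewrite /enorm => x1.
by rewrite -(sqr_sqrtr (dot_ge0 x)) x1 expr1n.
Qed.

Lemma cauchy_schwarz x y : dot x y ^+ 2 <= dot x x * dot y y.
Proof.
have [y0|y0] := eqVneq (dot y y) 0.
  rewrite (dot_eq0 y0) -(scale0r 0) !dotZr !mul0r mulr0 expr0n//=.
have yy : 0 < dot y y by rewrite lt_neqAle eq_sym y0 dot_ge0.
have := dot_ge0 (dot y y *: x - dot x y *: y).
rewrite !(dotDl, dotDr, dotNl, dotNr, dotZl, dotZr) (dotC y x).
set a := dot x x; set b := dot x y; set c := dot y y in yy *.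
rewrite [X in 0 <= X](_ : _ = c * (a * c - b ^+ 2)); last by ring.
by rewrite pmulr_rge0// subr_ge0.
Qed.

Definition geodesic (x y : sphere) : R := acos (dot x y).

Lemma sphere_dot_itv (x y : sphere) : -1 <= dot x y <= 1.
Proof.
have := cauchy_schwarz x y; rewrite !svec_dot mulr1 => xy.
by apply/andP; split; nra.
Qed.

Let cos_geodesic (x y : sphere) : cos (geodesic x y) = dot x y.
Proof. by rewrite acosK// in_itv/= sphere_dot_itv. Qed.

Let geodesic_itv (x y : sphere) : geodesic x y \in `[0, pi].
Proof. by rewrite in_itv/= acos_ge0 ?acos_lepi ?sphere_dot_itv. Qed.

Let geodesicxx (x : sphere) : geodesic x x = 0.
Proof. by rewrite /geodesic svec_dot acos1. Qed.

Let geodesic_positivity (x y : sphere) : geodesic x y = 0 -> x = y.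
Proof.
move=> /(congr1 cos); rewrite cos_geodesic cos0 => xy.
apply/val_inj/eqP; rewrite -subr_eq0; apply/eqP/dot_eq0.
rewrite !(dotDl, dotDr, dotNl, dotNr) (dotC (val y)) !svec_dot xy; ring.
Qed.

Let geodesic_sym (x y : sphere) : geodesic x y = geodesic y x.
Proof. by rewrite /geodesic dotC. Qed.

Let geodesic_triangle (y x z : sphere) : geodesic x z <= geodesic x y + geodesic y z.
Proof.
have /itvP xy := geodesic_itv x y; have /itvP yz := geodesic_itv y z.
have /itvP xz := geodesic_itv x z.
have [pi_le|lt_pi] := leP pi (geodesic x y + geodesic y z).
  by apply: le_trans pi_le; rewrite xz.
rewrite leNgt -ltr_cos ?geodesic_itv//; last first.
  by rewrite in_itv/= (ltW lt_pi) andbT addr_ge0 ?xy ?yz.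
rewrite -leNgt cosD !cos_geodesic /geodesic !sin_acos ?sphere_dot_itv//.
have := cauchy_schwarz (svec x - dot x y *: svec y) (svec z - dot y z *: svec y).
rewrite !(dotDl, dotDr, dotNl, dotNr, dotZl, dotZr) (dotC y x) (dotC z y).
rewrite !svec_dot.
have := sphere_dot_itv x y; have := sphere_dot_itv y z.
set a := dot x y; set b := dot y z; set c := dot x z => /andP[b1 b2] /andP[a1 a2].
rewrite [X in X ^+ 2](_ : _ = c - a * b); last by ring.
rewrite [X in _ <= X](_ : _ = (1 - a ^+ 2) * (1 - b ^+ 2)); last by ring.
rewrite -sqrtrM; last by nra.
move=> /ler_wsqrtr; rewrite sqrtr_sqr ler_norml => /andP[+ _]; lra.
Qed.

HB.instance Definition _ := @isMetric.Build R sphere geodesic geodesicxx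
  geodesic_positivity geodesic_sym geodesic_triangle.

Let antipode_subproof (x : sphere) : enorm (- svec x) == 1.
Proof. by rewrite /enorm dotNl dotNr opprK svec_dot sqrtr1. Qed.

Definition antipode (x : sphere) : sphere := Sphere (antipode_subproof x).

Lemma antipodeK : involutive antipode.
Proof. by move=> x; apply/val_inj; rewrite /= opprK. Qed.

Lemma antipode_isometry (x y : sphere) : mdist (antipode x) (antipode y) = mdist x y.
Proof.
by rewrite /mdist/= /geodesic/= dotNl dotNr opprK.
Qed.

End Sphere.

Section Main.
Variable R : realType.

Definition VR_sphere_opp n (r : R) : VR (sphere R n) r -> VR (sphere R n) r :=
  VR_opp (@antipodeK R n) (@antipode_isometry R n) (r := r).

Definition odd_map k n (r : R) (f : sphere R k -> VR (sphere R n) r) : Prop :=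
  continuous f /\ {morph f : x / antipode x >-> VR_sphere_opp x}.

Definition c_ (n k : nat) : R :=
  inf [set r : R | 0 <= r /\
    exists f : sphere R k -> VR (sphere R n) r, odd_map f].

Definition r_ (n : nat) : R := acos (- 1 / n.+1%:R).

End Main.

(* Main.v *)
Require Import Defs.
From HB Require Import structures.
From mathcomp Require Import all_boot all_order all_algebra finmap all_fingroup.
From mathcomp Require Import ring lra zify.
From mathcomp Require Import all_classical all_reals all_analysis.

(** Both infima are equal to r_n because there is no odd map S^(n+1) -> VR(S^n; r)
    for r < r_n, while there is an odd map S^(n+2) -> VR(S^n; r) for every r > r_n;
    composition with an equator S^(n+1) -> S^(n+2) turns the latter into an odd map
    on S^(n+1), and the former into the absence of odd maps on S^(n+2).

    Below r_n ([no_odd_map_below]). The barycentre map, which sends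
    sum_i lambda_i x_i in VR(S^n; r) to the vector sum_i lambda_i x_i, is continuous
    and odd. It has no zero: if 0 is a convex combination of unit vectors in
    dimension n+1 whose inner products are at least c, then c <= -1/(n+1)
    ([jung]). An odd map from S^(n+1) would thus give an odd map from S^(n+1) to
    R^(n+1) without zeros, against the Borsuk-Ulam theorem ([borsuk_ulam]).

    The Borsuk-Ulam theorem is derived from a parity count
    ([exists_flag_changes]): for odd sign functions theta_0, theta_1, ... on the
    signed coordinate vectors in {-1,0,1}^N, some complete flag X_0 < X_1 < ...
    satisfies theta_i(X_i) <> theta_i(X_(i+1)) for all i. In terms of cohomology, the
    product of N-1 copies of the generator of H^1 of the projective space of
    dimension N-1 is not zero, each theta_i providing a cocycle for this generator.
    Only m of the functions are needed for an odd map f from S^m to R^m. The others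
    are used to confine the end of the flag to a small neighbourhood of a point of
    S^m: with theta_i = sign of the last nonzero coordinate, the vectors of the flag
    alternate in sign, and averaging over m+1 blocks of coordinates yields nearby
    nonzero points of R^(m+1) between which each component of f changes sign
    ([discrete_borsuk_ulam]). Compactness does the rest.

    Above r_n ([exists_odd_map_above]). A finite measure on S^n can be spread over a
    fine antipodally symmetric net, at the price of a small increase of the diameter of
    its support; so it is enough to attach to each p in S^(n+2) a nonzero finite
    measure on S^n whose support has diameter at most r_n, continuously and oddly
    ([odd_map_of_masses]). Write p = (x, y) with x in R^(n+1) and y in R^2, so that
    S^(n+2) is seen as the join of S^n and S^1. To a unit vector v of R^2 belongs a
    regular simplex inscribed in S^n with vertices s_0(v), ..., s_(n+1)(v), the simplex
    of -v being the antipode of that of v ([simplex_loop]); take v = y/|y|. When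
    |y| = 1 the measure is equidistributed on the vertices s_k, and when y = 0 it is
    the unit mass at x. In between, let a_k >= 0 be the numbers with minimum 0 such
    that x is, up to a factor, sum_k a_k s_k. For a threshold h decreasing with |y|,
    the measure has masses max(a_k - h, 0) at the s_k, and mass max(h, 0) at the
    direction of z = sum_k min(a_k, h) s_k. If 0 < h < a_k then
    <s_k, z> >= h - (1/(n+1)) (n+1) h = 0, so the direction of z is no farther than pi/2
    from those vertices that still carry a mass. For h >= max_k a_k it is the
    direction of x, whatever the simplex is, which is why nothing goes wrong at
    y = 0, where v is not continuous. *)

Set Implicit Arguments.
Unset Strict Implicit.
Unset Printing Implicit Defensive.
Import Order.TTheory GRing.Theory Num.Theory.
Import numFieldNormedType.Exports.
Local Open Scope ring_scope.

(** * Flags of signed coordinate vectors *)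

(** Parities are written as exclusive ors, so that terms matched by an involution
    without fixed points cancel. *)
Lemma big_addb_involution (T : finType) (P F : pred T) (g : T -> T) :
    involutive g -> {homo g : x / P x} -> (forall x, P x -> g x != x) ->
    (forall x, P x -> F (g x) = F x) ->
  \big[addb/false]_(x | P x) F x = false.
Proof.
move=> gK gP gx gF.
have Pg x : P (g x) = P x by apply/idP/idP => [/gP|/gP//]; rewrite gK.
rewrite (bigID (fun x => enum_rank x < enum_rank (g x))%N)/=.
rewrite [X in _ (+) X](reindex_inj (inv_inj gK))/=.
rewrite [X in _ (+) X](eq_big (fun x => P x && (enum_rank x < enum_rank (g x))%N) F).
- by rewrite addbb.
- move=> x; rewrite Pg gK -leqNgt leq_eqVlt; case Px: (P x) => //=.
  case: eqP => // /ord_inj/enum_rank_inj gxx; have := gx _ Px.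
  by rewrite -gxx eqxx.
- by move=> x /andP[]; rewrite Pg => /gF.
Qed.

Section Flags.
Variables (R : pzRingType) (M : nat).
Local Notation N := M.+1.
Implicit Types (p : 'S_N * {ffun 'I_N -> bool}) (k i j : nat).

(** The permutation is the order in which the coordinates become nonzero and the
    booleans are their signs. The vectors [flag_vertex p 0], [flag_vertex p 1], ...
    are the vertices of a top simplex of the barycentric subdivision of the boundary
    of the cross-polytope, a triangulated sphere. *)
Definition flag_vertex p i : 'rV[R]_N :=
  \row_q (if (p.1^-1%g q <= i)%N then (-1) ^+ p.2 q else 0).

(** The first k + 1 vertices of these flags span the top simplices of the hemisphere
    where coordinate k is nonnegative, in the sphere of the first k + 1 coordinates. *)
Definition hemiflag k : pred ('S_N * {ffun 'I_N -> bool}) := fun p =>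
  [forall q : 'I_N, ((k < q)%N ==> (p.1 q == q)) && ((k <= q)%N ==> ~~ p.2 q)].

Lemma hemiflagP k p :
  reflect ((forall q : 'I_N, (k < q)%N -> p.1 q = q) /\
           (forall q : 'I_N, (k <= q)%N -> p.2 q = false)) (hemiflag k p).
Proof.
apply: (iffP forallP) => [h|[h1 h2] q].
  split=> q kq; have /andP[/implyP h1 /implyP h2] := h q.
    exact/eqP/h1.
  exact/negbTE/h2.
by apply/andP; split; apply/implyP => kq; [rewrite h1|rewrite h2].
Qed.

Definition flag_swap i p := ((tperm (inord i) (inord i.+1) * p.1)%g, p.2).

Lemma flag_swapK i : involutive (flag_swap i).
Proof. by move=> [s e]; rewrite /flag_swap/= mulgA tperm2 mul1g. Qed.

(** Exchanging the coordinates that come at steps i and i + 1 only moves vertex i: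
    this is the second top simplex that contains the face opposite to vertex i. *)
Lemma flag_swap_vertex i p j : (i < M)%N -> j != i ->
  flag_vertex (flag_swap i p) j = flag_vertex p j.
Proof.
move=> iM ji; apply/rowP => q; rewrite !mxE/= invMg tpermV permM.
suff -> : (tperm (inord i) (inord i.+1) (p.1^-1%g q) <= j)%N = (p.1^-1%g q <= j)%N by [].
case: tpermP => [->|->|//]; rewrite !inordK; lia.
Qed.

Lemma sum_hemiflag_swap k i (F : pred _) : (i < k <= M)%N ->
  (forall p, F (flag_swap i p) = F p) ->
  \big[addb/false]_(p | hemiflag k p) F p = false.
Proof.
move=> /andP[ik kM] FE; apply: (big_addb_involution (@flag_swapK i)) => [[s e]|[s e] _|p _//].
- move=> /hemiflagP[/= h1 h2]; apply/hemiflagP; split => //= q kq.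
  rewrite permM tpermD ?h1// -val_eqE/= ?inordK; lia.
- apply/eqP => -[] /(congr1 (fun t => t * s^-1)%g); rewrite mulgK mulgV.
  move=> /permP/(_ (inord i)); rewrite tpermL perm1 => /(congr1 val)/=.
  rewrite !inordK; lia.
Qed.

Definition flag_flip p (A : pred 'I_N) : 'S_N * {ffun 'I_N -> bool} :=
  (p.1, [ffun q => p.2 q (+) A q]).

Lemma flag_flipK A : involutive (flag_flip^~ A).
Proof.
by move=> [s e]; congr (_, _); apply/ffunP => q; rewrite !ffunE addbK.
Qed.

Variable theta : nat -> 'rV[R]_N -> bool.
Hypothesis theta_odd : forall i p j, theta i (- flag_vertex p j) = ~~ theta i (flag_vertex p j).

Definition sign_change i (X Y : 'rV[R]_N) := theta i X (+) theta i Y.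

(** The cup product of the coboundaries of the first k functions, evaluated on a flag. *)
Definition flag_changes k p :=
  \big[andb/true]_(0 <= i < k) sign_change i (flag_vertex p i) (flag_vertex p i.+1).

(** The Leibniz rule, summed over a hemisphere. The last factor of
    [flag_changes k.+1] is the sum of [theta k] at vertices k and k + 1, and the part
    with vertex k + 1 does not contribute. *)
Lemma sum_flag_changesS k : (k < M)%N ->
  \big[addb/false]_(p | hemiflag k.+1 p) flag_changes k.+1 p =
  \big[addb/false]_(p | hemiflag k.+1 p)
     (flag_changes k p && theta k (flag_vertex p k)).
Proof.
move=> kM.
pose P i p := [&& flag_changes i p, theta k (flag_vertex p k.+1) &
  \big[andb/true]_(i <= j < k) sign_change j (flag_vertex p j.+1) (flag_vertex p j.+2)].
have P0 i : (i <= k)%N -> \big[addb/false]_(p | hemiflag k.+1 p) P i p = false.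
  (* Vertex 0 does not occur in [P 0], and vertex i + 1 does not occur in
     [P i (+) P i.+1], because the values at this vertex cancel: the swaps apply. *)
  elim: i => [|i IH] ik.
    apply: (@sum_hemiflag_swap _ 0); first lia.
    move=> p; rewrite /P /flag_changes !(@big_geq _ _ _ 0 0)//= flag_swap_vertex//; last lia.
    congr (_ && _); apply: eq_bigr => j _.
    by rewrite !flag_swap_vertex//; lia.
  have : \big[addb/false]_(p | hemiflag k.+1 p) (P i p (+) P i.+1 p) = false;
    last by rewrite big_split/= IH// ltnW.
  apply: (@sum_hemiflag_swap _ i.+1); first lia.
  move=> p; rewrite /P /flag_changes big_nat_recr//= (big_ltn (m := i))//=.
  rewrite [in RHS]big_nat_recr//= [in RHS](big_ltn (m := i))//=.
  have e1 q : \big[andb/true]_(0 <= j < i) sign_change j (flag_vertex (flag_swap i.+1 q) j) (flag_vertex (flag_swap i.+1 q) j.+1) = \big[andb/true]_(0 <= j < i) sign_change j (flag_vertex q j) (flag_vertex q j.+1).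
    by apply: eq_big_nat => j jl; rewrite !flag_swap_vertex//; lia.
  have e2 q : \big[andb/true]_(i.+1 <= j < k) sign_change j (flag_vertex (flag_swap i.+1 q) j.+1) (flag_vertex (flag_swap i.+1 q) j.+2) = \big[andb/true]_(i.+1 <= j < k) sign_change j (flag_vertex q j.+1) (flag_vertex q j.+2).
    by apply: eq_big_nat => j jl; rewrite !flag_swap_vertex//; lia.
  rewrite !e1 !e2 /sign_change.
  rewrite !(@flag_swap_vertex _ _ i) ?(@flag_swap_vertex _ _ i.+2) ?(@flag_swap_vertex _ _ k.+1)//; try lia.
pose G p := flag_changes k p && theta k (flag_vertex p k).
rewrite (eq_bigr (fun p => G p (+) P k p)) => [|p _].
  by rewrite big_split/= P0// addbF.
rewrite /G /P /flag_changes big_nat_recr//= [X in _ && (_ && X)]big_geq//= andbT.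
by rewrite /sign_change; case: (bigop _ _ _) => //=.
Qed.

Lemma flag_flip_vertex p j (A : pred 'I_N) : (forall q : 'I_N, (q <= j)%N -> A (p.1 q)) ->
  flag_vertex (flag_flip p A) j = - flag_vertex p j.
Proof.
move=> hA; apply/rowP => q; rewrite !mxE/= ffunE.
case: ifPn => [qj|]; last by rewrite oppr0.
by rewrite -{2}(permKV p.1 q) hA// signr_addb/= expr1 mulrN1.
Qed.

Lemma flag_flip_vertexN p j (A : pred 'I_N) : (forall q : 'I_N, (q <= j)%N -> ~~ A (p.1 q)) ->
  flag_vertex (flag_flip p A) j = flag_vertex p j.
Proof.
move=> hA; apply/rowP => q; rewrite !mxE/= ffunE.
case: ifPn => [qj|//].
by rewrite -{2}(permKV p.1 q) (negbTE (hA _ _))// addbF.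
Qed.

Lemma hemiflag_perm_le k p (q : 'I_N) : hemiflag k p -> (q <= k)%N -> (p.1 q <= k)%N.
Proof.
move=> /hemiflagP[h _] qk; rewrite leqNgt; apply/negP => kq.
by have := h _ kq => /perm_inj pq; rewrite pq in kq; lia.
Qed.

(** By induction on the dimension. Flipping the sign of the coordinate that comes
    last pairs the flags of a hemisphere, except for those where it is the last
    coordinate of the sphere; these are the flags of the equator, which consists of two
    antipodal hemispheres. As the sign changes are invariant under the antipodal map
    and [theta k] is odd, their contributions add up to the sum over one hemisphere of
    dimension k. *)
Lemma sum_flag_changes k : (k <= M)%N ->
  \big[addb/false]_(p | hemiflag k p) flag_changes k p = true.
Proof.
elim: k => [|k IH] kM.
  rewrite (big_pred1 (1%g, [ffun => false])) /flag_changes ?big_geq//.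
  move=> [s e]; apply/hemiflagP/eqP => /= [[h1 h2]|[-> ->]]; last first.
    by split=> q _; rewrite ?perm1 ?ffunE.
  have s1 (q : 'I_N) : (0 < q)%N -> s q = q by exact: h1.
  congr (_, _); last by apply/ffunP => q; rewrite ffunE h2.
  apply/permP => q; rewrite perm1; have [q0|] := posnP q; last exact: s1.
  have [sq0|/s1/perm_inj//] := posnP (s q).
  by apply/val_inj; rewrite /= sq0 q0.
rewrite sum_flag_changesS//.
rewrite (bigID (fun p => p.1 (inord k.+1) == inord k.+1))/= addbC.
pose F p := flag_changes k p && theta k (flag_vertex p k).
rewrite (_ : \big[_/_]_(p | _ && ~~ _) _ = false) ?addFb; last first.
  pose g p := flag_flip p (pred1 (p.1 (inord k.+1))).
  apply: (@big_addb_involution _ _ F g) => [p|p /andP[pk pn]|p _|p /andP[pk pn]].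
  - exact: flag_flipK.
  - apply/andP; split => //; apply/hemiflagP => /=; have /hemiflagP[h1 h2] := pk.
    split=> // q kq; rewrite ffunE h2//=; apply/negbTE; apply: contra pn.
    move=> /eqP qE; rewrite -qE; apply/eqP/val_inj; rewrite /= inordK//.
    apply/eqP; rewrite eqn_leq kq andbT qE.
    by rewrite (hemiflag_perm_le pk)// inordK.
  - rewrite /g; case: p => s e; apply/eqP => -[] /ffunP /(_ (s (inord k.+1))).
    by rewrite ffunE/= eqxx; case: (e _).
  - have vE j : (j <= k)%N -> flag_vertex (g p) j = flag_vertex p j.
      move=> jk; apply: flag_flip_vertexN => q qj /=.
      rewrite (inj_eq perm_inj) -val_eqE/= inordK//; lia.
    rewrite /F vE//; congr (_ && _); apply: eq_big_nat => j jk.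
    by rewrite !vE; lia.
pose A (q : 'I_N) := (q <= k)%N.
rewrite (bigID (fun p => ~~ p.2 (inord k)))/=.
rewrite [X in _ (+) X](reindex_inj (inv_inj (flag_flipK A)))/=.
have kN : (k < N)%N by lia.
have hE p : hemiflag k.+1 p && (p.1 (inord k.+1) == inord k.+1) && ~~ p.2 (inord k) =
    hemiflag k p.
  apply/andP/hemiflagP => [[/andP[/hemiflagP[h1 h2] h3] h4]|[h1 h2]].
    split=> q; rewrite leq_eqVlt.
      by case/orP => [/eqP kq|/h1//]; apply/eqP; rewrite (_ : q = inord k.+1)//; apply/val_inj; rewrite /= inordK.
    by case/orP => [/eqP kq|/h2//]; apply/negbTE; rewrite (_ : q = inord k)//; apply/val_inj; rewrite /= inordK.
  rewrite h2 ?inordK//; split=> //; rewrite h1 ?inordK// eqxx andbT.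
  by apply/hemiflagP; split=> q kq; [apply: h1|apply: h2]; lia.
rewrite (eq_bigl _ _ hE) [X in _ (+) X](eq_bigl (hemiflag k)) => [|p]; last first.
  rewrite negbK.
  apply/andP/hemiflagP => [[/andP[/hemiflagP[/= h1 h2] h3] h4]|[h1 h2]].
    split=> q; rewrite leq_eqVlt.
      by case/orP => [/eqP kq|/h1//]; apply/eqP; rewrite (_ : q = inord k.+1)//; apply/val_inj; rewrite /= inordK.
    case/orP => [/eqP kq|kq].
      move: h4; rewrite ffunE /A inordK// leqnn addbT (_ : inord k = q) => [/negbTE//|].
      by apply/val_inj; rewrite /= inordK.
    by have := h2 _ kq; rewrite ffunE /A leqNgt kq addbF.
  rewrite /= ffunE h2 ?inordK// /A inordK// leqnn; split=> //.
  rewrite h1 ?inordK// eqxx andbT.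
  apply/hemiflagP; split=> q kq /=; first by apply: h1; lia.
  by rewrite ffunE h2 ?(ltnW kq)//= /A leqNgt kq.
rewrite -big_split/= -[RHS](IH (ltnW kM)); apply: eq_bigr => p pk.
have vE j : (j <= k)%N -> flag_vertex (flag_flip p A) j = - flag_vertex p j.
  move=> jk; apply: flag_flip_vertex => q qj; apply: hemiflag_perm_le => //; lia.
rewrite (_ : flag_changes k (flag_flip p A) = flag_changes k p); last first.
  apply: eq_big_nat => j /andP[_ jk]; rewrite /sign_change vE 1?ltnW// vE// !theta_odd.
  by rewrite addNb addbN negbK.
rewrite vE// theta_odd; case: (flag_changes _ _) => //=; by rewrite addbN addbb.
Qed.

Lemma exists_flag_changes : exists p, forall i, (i < M)%N ->
  theta i (flag_vertex p i) != theta i (flag_vertex p i.+1).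
Proof.
have [p pM|no] := pickP (flag_changes M).
  exists p => i iM; move: pM.
  rewrite /flag_changes (big_rem i) ?mem_index_iota//= => /andP[+ _].
  by rewrite /sign_change; case: (theta _ _) (theta _ _) => -[].
have := sum_flag_changes (leqnn M); rewrite big1// => p _; exact: no.
Qed.

End Flags.

(** * A discrete Borsuk-Ulam theorem *)

Section LastSign.
Variables (R : realFieldType) (M : nat).
Local Notation N := M.+1.
Implicit Types (X : 'rV[R]_N) (p : 'S_N * {ffun 'I_N -> bool}).

Definition last_pos X :=
  [exists q, (0 < X 0 q) && [forall r : 'I_N, (q < r)%N ==> (X 0 r == 0)]].

Lemma last_posE X q : X 0 q != 0 -> (forall r : 'I_N, (q < r)%N -> X 0 r = 0) ->
  last_pos X = (0 < X 0 q).
Proof.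
move=> Xq Xr; apply/existsP/idP => [[s /andP[Xs /forallP sr]]|Xq0].
  have [qs|sq|/val_inj->//] := ltngtP q s.
    by move: Xs; rewrite Xr// ltxx.
  by have := sr q; rewrite sq (negbTE Xq).
by exists q; rewrite Xq0; apply/forallP => r; apply/implyP => /Xr ->.
Qed.

Lemma flag_vertex_top p i : exists q : 'I_N, [/\ (p.1^-1%g q <= i)%N,
  forall r : 'I_N, (p.1^-1%g r <= i)%N -> (r <= q)%N & last_pos (flag_vertex R p i) = ~~ p.2 q].
Proof.
have p0 : (p.1^-1%g (p.1 ord0) <= i)%N by rewrite permK.
case: (@arg_maxnP _ _ (fun q => p.1^-1%g q <= i)%N (fun q : 'I_N => nat_of_ord q) p0) => q qi qmax.
exists q; split => //; rewrite (@last_posE _ q).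
- by rewrite mxE qi; case: (p.2 q) => /=; rewrite ?expr1 ?expr0 ?ltr01// ltr0N1.
- by rewrite mxE qi signr_eq0.
- by move=> r qr; rewrite mxE; case: ifP => // /qmax; rewrite /= leqNgt qr.
Qed.

Lemma last_pos_opp X : X != 0 -> last_pos (- X) = ~~ last_pos X.
Proof.
move=> X0; have [q0 Xq0] : exists q, X 0 q != 0.
  apply/existsP; apply: contraNT X0 => /existsPn X0.
  by apply/eqP/rowP => q; rewrite mxE; apply/eqP; have := X0 q; rewrite negbK.
have [q Xq qmax] := @arg_maxnP _ q0 (fun q => X 0 q != 0) (fun q : 'I_N => nat_of_ord q) Xq0.
have Xr (r : 'I_N) : (q < r)%N -> X 0 r = 0.
  by move=> qr; apply/eqP; apply: contraTT qr => /qmax /=; rewrite leqNgt.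
rewrite (last_posE Xq Xr) (@last_posE _ q) ?mxE ?oppr_eq0// => [|r /Xr Xr0].
  by rewrite oppr_gt0 -leNgt le_eqVlt (negbTE Xq).
by rewrite mxE Xr0 oppr0.
Qed.

Lemma flag_vertex_neq0 p i : flag_vertex R p i != 0.
Proof.
apply/eqP => /rowP/(_ (p.1 ord0)); rewrite !mxE permK /= => /eqP.
by rewrite signr_eq0.
Qed.

(** If the sign of the last nonzero coordinate changes at each step, then each new
    coordinate must come after all the previous ones, with the opposite sign. *)
Lemma last_pos_alternating p K : (K <= M)%N ->
  (forall i, (i < K)%N ->
     last_pos (flag_vertex R p i) != last_pos (flag_vertex R p i.+1)) ->
  forall i, (i < K)%N -> (forall j, (j <= i)%N -> (p.1 (inord j) < p.1 (inord i.+1))%N)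
    /\ p.2 (p.1 (inord i.+1)) = ~~ p.2 (p.1 (inord i)).
Proof.
move=> KM alt.
have vE j : (j <= M)%N -> nat_of_ord (inord j : 'I_N) = j by move=> ?; rewrite inordK.
have top i : (i <= K)%N -> (forall j, (j < i)%N -> (p.1 (inord j) < p.1 (inord i))%N) ->
    last_pos (flag_vertex R p i) = ~~ p.2 (p.1 (inord i)).
  move=> iK inc; have [q [qi qmax ->]] := flag_vertex_top p i.
  have : (p.1 (inord i) <= q)%N by apply: qmax; rewrite permK vE//; lia.
  rewrite leq_eqVlt => /orP[/eqP/val_inj-> //|iq].
  have := inc (p.1^-1%g q); rewrite inord_val permKV.
  move: qi; rewrite leq_eqVlt => /orP[/eqP iE|qi /(_ qi)]; last by lia.
  by move: iq; rewrite -iE inord_val permKV ltnn.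
have inc i : (i <= K)%N -> (forall j, (j < i)%N -> (p.1 (inord j) < p.1 (inord i))%N).
  elim: i => // i IH iK j; rewrite ltnS => ji.
  have inci := IH (ltnW iK).
  suff ii1 : (p.1 (inord i) < p.1 (inord i.+1))%N.
    by move: ji; rewrite leq_eqVlt => /orP[/eqP->//|/inci ji]; exact: ltn_trans ji ii1.
  rewrite ltnNge; apply/negP; rewrite leq_eqVlt => /orP[/eqP/val_inj/perm_inj/(congr1 val)/=|].
    by rewrite !vE; lia.
  move=> ii1; have := alt i iK; rewrite (top i (ltnW iK) inci).
  have [q [qi qmax ->]] := flag_vertex_top p i.+1.
  suff -> : q = p.1 (inord i) by rewrite eqxx.
  have iq : (p.1 (inord i) <= q)%N by apply: qmax; rewrite permK vE; lia.
  apply/val_inj/eqP; rewrite /= eqn_leq iq andbT.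
  move: qi; rewrite leq_eqVlt => /orP[/eqP qi|].
    by move: ii1; rewrite -qi inord_val permKV => /ltnW.
  rewrite ltnS leq_eqVlt => /orP[/eqP qi|qi].
    by rewrite -qi inord_val permKV.
  by have := inci _ qi; rewrite inord_val permKV => /ltnW.
move=> i iK; split => [j ji|]; first by apply: inc.
have := alt i iK; rewrite (top i (ltnW iK) (inc _ (ltnW iK))) (top i.+1 iK (inc _ iK)).
by case: (p.2 _) (p.2 _) => -[].
Qed.

End LastSign.

Section Blocks.
Variables (R : realFieldType) (m l : nat).
Local Notation M := (m.+1 * l.+1).-1.
Local Notation N := M.+1.
Implicit Types (X : 'rV[R]_N) (p : 'S_N * {ffun 'I_N -> bool}).

Definition block_coord (b : 'I_m.+1) (s : nat) : 'I_N := inord (b * l.+1 + s).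

Lemma block_coordE b s : (s <= l)%N -> block_coord b s = (b * l.+1 + s)%N :> nat.
Proof.
by move=> sl; rewrite inordK// prednK// -ltn_subRL; have := ltn_ord b; nia.
Qed.

Lemma block_coord_inj b s t : (s <= l)%N -> (t <= l)%N -> block_coord b s = block_coord b t -> s = t.
Proof. by move=> sl tl /(congr1 val); rewrite /= !block_coordE// => /addnI. Qed.

(** With the factor (-1)^q, the mean of a block of coordinates with alternating signs
    is 1 or -1. *)
Definition block_mean X : 'rV[R]_m.+1 :=
  \row_b ((\sum_(s < l.+1) (-1) ^+ block_coord b s * X 0 (block_coord b s)) / l.+1%:R).

Lemma block_meanN X : block_mean (- X) = - block_mean X.
Proof.
apply/rowP => b; rewrite !mxE -mulNr -sumrN; congr (_ / _).
by apply: eq_bigr => s _; rewrite mxE mulrN.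
Qed.

Lemma block_size_gt0 : 0 < l.+1%:R :> R. Proof. by rewrite ltr0n. Qed.
#[local] Hint Resolve block_size_gt0 : core.

Lemma block_mean_le1 p i b : `|block_mean (flag_vertex R p i) 0 b| <= 1.
Proof.
rewrite mxE normrM normfV (ger0_norm (ltW block_size_gt0)) ler_pdivrMr// mul1r.
apply: le_trans (ler_norm_sum _ _ _) _.
rewrite -[leRHS]mulr1 mulr_natl -[X in _ *+ X]card_ord -sumr_const.
apply: ler_sum => s _; rewrite normrM normrX normrN1 expr1n mul1r mxE.
by case: ifP; rewrite ?normr0// normrX normrN1 expr1n.
Qed.

Lemma block_mean_step p i b :
  `|block_mean (flag_vertex R p i.+1) 0 b - block_mean (flag_vertex R p i) 0 b|
    <= l.+1%:R^-1.
Proof.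
rewrite !mxE -mulrBl -sumrB normrM normfV (ger0_norm (ltW block_size_gt0)).
rewrite ler_piMl ?invr_ge0 ?(ltW block_size_gt0)//.
have D s : (-1) ^+ block_coord b s * flag_vertex R p i.+1 0 (block_coord b s) -
     (-1) ^+ block_coord b s * flag_vertex R p i 0 (block_coord b s) =
     if p.1^-1%g (block_coord b s) == i.+1 :> nat then (-1) ^+ (block_coord b s) * (-1) ^+ p.2 (block_coord b s) else 0.
  rewrite !mxE; case: (ltngtP (p.1^-1%g (block_coord b s)) i.+1) => [si|si|->].
  - by rewrite -ltnS si subrr.
  - by rewrite leqNgt ltnW ?mulr0 ?subrr.
  - by rewrite ltnn mulr0 subr0.
under eq_bigr do rewrite D.
have [s0 /eqP s0E|no] := pickP (fun s : 'I_l.+1 => p.1^-1%g (block_coord b s) == i.+1 :> nat).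
  rewrite (bigD1 s0)//= s0E eqxx big1 ?addr0 => [|s ss0].
    by rewrite normrM !normrX normrN1 !expr1n mulr1.
  case: eqP => // sE; case/eqP: ss0; apply/val_inj/(@block_coord_inj b); [exact: leq_ord|exact: leq_ord|].
  by apply/(@perm_inj _ p.1^-1%g)/val_inj; rewrite /= s0E sE.
by rewrite big1 ?normr0// => s _; rewrite no.
Qed.

(** Only m coordinates are zero at step M - m, so that one of the m + 1 blocks
    contains none of them. Its coordinates were added in order with alternating signs. *)
Lemma block_mean_unit p :
  (forall i, (i < M - m)%N ->
     last_pos (flag_vertex R p i) != last_pos (flag_vertex R p i.+1)) ->
  exists b, forall i, (M - m <= i)%N -> `|block_mean (flag_vertex R p i) 0 b| = 1.
Proof.
set K := (M - m)%N => alt.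
have mM : (m <= M)%N by rewrite -ltnS prednK//; nia.
have alt' := last_pos_alternating (leq_subr m M) alt.
pose miss (t : 'I_m) : 'I_m.+1 := inord (p.1 (inord (K.+1 + t)) %/ l.+1).
have [b bn|all_in] := pickP (fun b => b \notin [set miss t | t in 'I_m]); last first.
  have : (#|[set: 'I_m.+1]| <= #|[set miss t | t in 'I_m]|)%N.
    by apply/subset_leq_card/fintype.subsetP => b _; have := all_in b; rewrite /= => /negbFE.
  move=> /leq_trans/(_ (leq_imset_card _ _)).
  by rewrite cardsT !card_ord ltnn.
have inK s : (s <= l)%N -> (p.1^-1%g (block_coord b s) <= K)%N.
  move=> sl; rewrite leqNgt; apply/negP => Ks.
  have tm : (p.1^-1%g (block_coord b s) - K.+1 < m)%N.
    by have := ltn_ord (p.1^-1%g (block_coord b s)); lia.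
  case/imsetP: bn; exists (Ordinal tm) => //.
  rewrite /miss /= subnKC// inord_val permKV block_coordE//.
  by rewrite divnMDl// divn_small// addn0 inord_val.
have step s : (s < l)%N -> p.2 (block_coord b s.+1) = ~~ p.2 (block_coord b s).
  move=> sl; have ss : block_coord b s.+1 = (block_coord b s).+1 :> nat.
    by rewrite !block_coordE ?(ltnW sl)// addnS.
  have mono u v : (p.1^-1%g u < p.1^-1%g v)%N -> (p.1^-1%g v <= K)%N -> (u < v)%N.
    case: (p.1^-1%g v) (permKV p.1 v) => -[//|i'] i'N <- /= ui i'K.
    have := (alt' i' i'K).1 _ ui; rewrite inord_val permKV.
    by rewrite (_ : inord _ = Ordinal i'N)//; apply/val_inj; rewrite /= inordK.
  set i := p.1^-1%g (block_coord b s); set i' := p.1^-1%g (block_coord b s.+1).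
  have iK : (i <= K)%N by apply: inK; exact: ltnW.
  have i'K : (i' <= K)%N by exact: inK.
  have ii' : (i < i')%N.
    rewrite ltnNge; apply/negP; rewrite leq_eqVlt => /orP[/eqP/val_inj/perm_inj e|i'i].
      by move: ss; rewrite e; lia.
    by have := mono _ _ i'i iK; rewrite ss; lia.
  have i'E : i' = i.+1 :> nat.
    apply/eqP; rewrite eqn_leq ii' andbT leqNgt; apply/negP => i1i'.
    pose c := p.1 (inord i.+1).
    have cE : p.1^-1%g c = i.+1 :> nat by rewrite permK inordK//; lia.
    have := mono (block_coord b s) c; have := mono c (block_coord b s.+1).
    by rewrite cE -/i -/i' ss; lia.
  have := (alt' i (leq_trans ii' i'K)).2; rewrite -i'E !inord_val.
  by rewrite !permKV.
have const s : (s <= l)%N -> (-1) ^+ block_coord b s * (-1) ^+ p.2 (block_coord b s) =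
    (-1) ^+ block_coord b 0 * (-1) ^+ p.2 (block_coord b 0) :> R.
  elim: s => // s IH sl; rewrite -(IH (ltnW sl)) (step _ sl) signrN.
  have -> : block_coord b s.+1 = (block_coord b s).+1 :> nat by rewrite !block_coordE ?(ltnW sl)// addnS.
  by rewrite exprS mulN1r mulrNN.
exists b => i Ki; rewrite mxE.
rewrite (eq_bigr (fun=> (-1) ^+ block_coord b 0 * (-1) ^+ p.2 (block_coord b 0))) => [|s _].
  rewrite sumr_const card_ord -[X in X / _]mulr_natr mulfK ?gt_eqF//.
  by rewrite normrM !normrX normrN1 !expr1n mulr1.
by rewrite -(const s (leq_ord s)) mxE ifT// (leq_trans _ Ki)// inK// leq_ord.
Qed.

(** The sign functions of the first M - m steps make the signs alternate; those of the
    last m steps are the signs of the f i at the block means. Where f i vanishes, the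
    sign of the last nonzero coordinate is used instead, to keep the function odd. *)
Lemma discrete_borsuk_ulam (f : nat -> 'rV[R]_m.+1 -> R) :
  (forall i x, f i (- x) = - f i x) ->
  exists y : nat -> 'rV[R]_m.+1, [/\
    exists b, forall i, `|y i 0 b| = 1,
    forall i b, `|y i 0 b| <= 1,
    forall i b, `|y i.+1 0 b - y i 0 b| <= l.+1%:R^-1 &
    forall i, (i < m)%N -> f i (y i) * f i (y i.+1) <= 0].
Proof.
move=> f_odd; pose K := (M - m)%N.
have mM : (m <= M)%N by rewrite -ltnS prednK//; nia.
pose theta i X := if (i < K)%N then last_pos X else
  let a := f (i - K)%N (block_mean X) in if a == 0 then last_pos X else 0 < a.
have [|p pP] := @exists_flag_changes R M theta.
  move=> i p j; rewrite /theta; case: ifP => _; first exact/last_pos_opp/flag_vertex_neq0.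
  rewrite /= block_meanN f_odd oppr_eq0; case: eqVneq => [_|/negbTE f0]; first exact/last_pos_opp/flag_vertex_neq0.
  by rewrite oppr_gt0 -leNgt le_eqVlt f0.
exists (fun i => block_mean (flag_vertex R p (K + i))); split.
- have [|b bP] := @block_mean_unit p.
    by move=> i iK; have := pP i; rewrite /theta iK; apply; lia.
  by exists b => i; rewrite bP ?leq_addr.
- by move=> i b; exact: block_mean_le1.
- by move=> i b; rewrite addnS; exact: block_mean_step.
- move=> i im; have := pP (K + i)%N; rewrite /theta (_ : (K + i < K)%N = false) ?addKn; last by lia.
  rewrite addnS.
  have -> : (K + i < M)%N by rewrite /K; lia.
  move=> /(_ isT); set a := f _ _; set c := f _ _.
  have [->|a0] := eqVneq a 0; first by rewrite mul0r.
  have [->|c0] := eqVneq c 0; first by rewrite mulr0.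
  have [a_gt|a_lt] := ltP 0 a; have [c_gt|c_lt] := ltP 0 c => // _; nra.
Qed.

End Blocks.

(** * The Borsuk-Ulam theorem *)

Local Open Scope classical_set_scope.

(** As the block size l grows, the sign changes of the f i given by
    [discrete_borsuk_ulam] take place in smaller and smaller neighbourhoods of points
    with a coordinate 1 or -1. At an accumulation point x of these, which is not 0,
    no f i can have a constant sign near x. *)
Lemma borsuk_ulam (R : realType) m (f : 'I_m -> 'rV[R]_m.+1 -> R) :
  (forall i x, x != 0 -> {for x, continuous (f i)}) ->
  (forall i x, x != 0 -> f i (- x) = - f i x) ->
  exists2 x, x != 0 & forall i, f i x = 0.
Proof.
move=> f_cont f_odd.
(* The value 0 at x = 0 makes F odd everywhere. *)
pose F (i : nat) x := if insub i is Some k then if x == 0 then 0 else f k x else 0.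
have F_odd i x : F i (- x) = - F i x.
  rewrite /F oppr_eq0; case: insubP => [k _ _|_]; last by rewrite oppr0.
  by case: eqVneq => [_|/f_odd]; rewrite ?oppr0.
have /choice[y yP] := fun l => @discrete_borsuk_ulam R m l F F_odd.
pose box := [set v : 'rV[R]_m.+1 | forall b, `[-1, 1]%classic (v ord0 b)].
have box_compact : compact box.
  by apply: (@rV_compact R m.+1 (fun=> `[-1, 1]%classic)) => b; exact: segment_compact.
pose u l := y l 0%N.
have [|x [_ x_cluster]] := box_compact (u @ \oo) _.
  apply: (filterE (F := \oo)) => l b /=; have [_ y1 _ _] := yP l.
  by rewrite in_itv/= -ler_norml; exact: y1.
have close e L : 0 < e -> exists2 l, (L <= l)%N & ball x e (u l).
  move=> e0; suff [_ [[l /= Ll <-] xl]] : [set u l | l in [set l | (L <= l)%N]] `&` ball x e !=set0.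
    by exists l.
  apply: x_cluster; last exact: nbhsx_ballx.
  by exists L => // l Ll; exists l.
have ball_rV e (v w : 'rV[R]_m.+1) : 0 < e -> ball v e w <-> forall b, `|v ord0 b - w ord0 b| < e.
  by move=> e0; split => [[_ vw] b|vw]; [exact: vw|split=> // i b; rewrite ord1; exact: vw].
have x0 : x != 0.
  have h0 : 0 < 1 / 2 :> R by lra.
  have [l _ /(ball_rV _ _ _ h0) xl] := close _ 0%N h0.
  have [[b /(_ 0%N) b1] _ _ _] := yP l.
  apply/eqP => x0; have := xl b; rewrite x0 mxE sub0r normrN.
  rewrite /u in b1 *; rewrite b1; lra.
exists x => // i; apply/eqP/negP => /negP fi0.
have /cvgrPdist_lt/(_ `|f i x|) := f_cont i x x0; rewrite normr_gt0 fi0 => /(_ isT).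
move=> /nbhs_ballP[e /= e0 fe].
have [l0 _ l0P] := near_infty_natSinv_lt (PosNum (divr_gt0 e0 (ltr0Sn R (2 * m)))).
have e20 : 0 < e / 2 by lra.
have [l l0l /(ball_rV _ _ _ e20) xl] := close _ l0 e20.
have [[b0 y1] _ ystep ysgn] := yP l.
have y0 j : y l j == 0 = false.
  apply/negbTE/eqP => yj; have := y1 j; rewrite yj mxE normr0 => /eqP.
  by rewrite eq_sym oner_eq0.
have le := l0P l l0l.
have ydist j b : (j <= m)%N -> `|x ord0 b - y l j ord0 b| < e.
  move=> jm; have yj : `|y l 0%N ord0 b - y l j ord0 b| <= j%:R / l.+1%:R.
    elim: j jm => [|j IH] jm; first by rewrite subrr normr0 mul0r.
    rewrite -(subrKA (y l j ord0 b)); apply: le_trans (ler_normD _ _) _.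
    by rewrite -natr1 mulrDl mul1r lerD ?IH 1?ltnW// distrC.
  have : j%:R / l.+1%:R <= m%:R / l.+1%:R :> R.
    by rewrite ler_pM2r ?invr_gt0// ler_nat.
  have : m%:R / l.+1%:R <= e / 2.
    have : l.+1%:R^-1 * (2 * m).+1%:R < e by rewrite -ltr_pdivlMr.
    have : 0 <= l.+1%:R^-1 :> R by rewrite invr_ge0.
    rewrite -[(2 * m).+1%:R]natr1 natrM; set t := _^-1; set k := m%:R => t0; lra.
  have : `|x ord0 b - y l 0%N ord0 b| < e / 2 := xl b.
  have := ler_normD (x ord0 b - y l 0%N ord0 b) (y l 0%N ord0 b - y l j ord0 b).
  rewrite subrKA => h1 h2 h3 h4; have := le_trans yj (le_trans h4 h3).
  move: h1 h2; set a := `|_|; set c := `|_|; set d := `|_|. lra.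
have := ysgn i (ltn_ord i); rewrite /F insubT/=; first exact: ltn_ord.
move=> im; rewrite !y0 (_ : Sub _ _ = i); last exact/val_inj.
have /fe h1 : ball x e (y l i) by apply/ball_rV => // b; apply: ydist; exact: ltnW.
have /fe h2 : ball x e (y l i.+1) by apply/ball_rV => // b; exact: ydist.
move: h1 h2; rewrite /= !ltr_norml; set a := f i x; set c := f i _; set d := f i _.
have [a0|a0] := leP 0 a; rewrite ?(ger0_norm a0) ?(ltr0_norm a0) => /andP[h1 h2] /andP[h3 h4]; nra.
Qed.

(** * Topology of the round sphere *)

Lemma continuous_at_sum (R : realType) (T : topologicalType) (I : Type)
    (r : seq I) (P : pred I) (F : I -> T -> R) (x : T) :
  (forall i, P i -> {for x, continuous (F i)}) ->
  {for x, continuous (fun t => \sum_(i <- r | P i) F i t)}.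
Proof.
move=> Fc; apply: cvg_big => //; exact: add_continuous.
Qed.

Lemma continuous_at_near_eq (T U : topologicalType) (f g : T -> U) (t : T) :
  (\forall s \near t, f s = g s) -> {for t, continuous g} -> {for t, continuous f}.
Proof.
move=> fg gc; rewrite /prop_for /continuous_at (nbhs_singleton fg).
by apply: cvg_trans gc; apply: near_eq_cvg; apply: filterS fg => s ->.
Qed.

Section SphereTopology.
Variables (R : realType) (n : nat).
Implicit Types (x y : sphere R n) (v w : 'rV[R]_n.+1).

Lemma geodesic_lt x y e : 0 < e -> e <= pi -> (geodesic x y < e) = (cos e < dot x y).
Proof.
move=> e0 epi; have xy := sphere_dot_itv x y.
rewrite -ltr_cos ?in_itv/= ?acos_ge0 ?acos_lepi ?(ltW e0)//.
by rewrite acosK// in_itv.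
Qed.

Lemma geodesic_le x y e : 0 <= e -> e <= pi -> (geodesic x y <= e) = (cos e <= dot x y).
Proof.
move=> e0 epi; have xy := sphere_dot_itv x y.
rewrite leNgt -ltr_cos ?in_itv/= ?acos_ge0 ?acos_lepi ?e0//.
by rewrite acosK ?in_itv// -leNgt.
Qed.

Lemma dot0l v : dot 0 v = 0.
Proof. by rewrite /dot big1// => i _; rewrite mxE mul0r. Qed.

Lemma coord_sqr_le_dot v i : v 0 i ^+ 2 <= dot v v.
Proof.
rewrite /dot (bigD1 i)//= -expr2 lerDl sumr_ge0// => j _.
by rewrite -expr2 sqr_ge0.
Qed.

Lemma svec_continuous i : continuous (fun x : sphere R n => svec x 0 i).
Proof.
move=> x; apply/(cvgrPdist_lt (F := nbhs x)) => e e0.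
pose c : R := 1 - e ^+ 2 / 2.
have : \forall t \near (0 : R), c < cos t.
  have /cvgr_gt/(_ c) : cos t @[t --> (0 : R)] --> (1 : R).
    by rewrite -[X in _ --> X]cos0; exact: continuous_cos.
  apply; rewrite /c; nra.
move=> /nbhs_ballP[d /= d0 dc].
apply/nbhs_ballP; exists d => //= y xy.
have xy' : mdist x y < d by move: xy; rewrite ballEmdist.
have /dc : ball 0 d (mdist x y) by rewrite /ball/= sub0r normrN ger0_norm// mdist_ge0.
rewrite /= {1}/mdist/= /geodesic acosK; last by rewrite in_itv/= sphere_dot_itv.
move=> cxy; rewrite -ltr_sqr ?nnegrE// ?ltW// real_normK ?num_real//.
have := coord_sqr_le_dot (svec x - svec y) i; rewrite !mxE => /le_lt_trans; apply.
rewrite !(dotDl, dotDr, dotNl, dotNr) !svec_dot (dotC y x); rewrite /c in cxy; lra.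
Qed.

Lemma sphere_continuous_at (T : topologicalType) (g : T -> sphere R n) (t : T) :
  (forall i, {for t, continuous (fun s => svec (g s) 0 i)}) -> {for t, continuous g}.
Proof.
move=> gc; apply/cvg_ballP => e e0.
pose d := Num.min e pi.
have d0 : 0 < d by rewrite lt_min e0 pi_gt0.
have dpi : d <= pi by rewrite ge_min lexx orbT.
have : (fun s => dot (g t) (g s)) @ t --> (1 : R).
  rewrite -(svec_dot (g t)); apply: (@continuous_at_sum R T _ _ _ (fun i s => g t 0 i * g s 0 i)).
  by move=> i _; apply: cvgMl_tmp; exact: gc.
move=> /cvgr_gt/(_ (cos d)); have dlt : cos d < 1.
  by rewrite -cos0 ltr_cos// in_itv/= ?lexx ?pi_ge0// ltW.
move=> /(_ dlt); apply: filterS => s ds.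
rewrite ballEmdist; apply: lt_le_trans (_ : d <= e); last by rewrite ge_min lexx.
by rewrite /mdist/= geodesic_lt.
Qed.

Fact sphere_base_subproof : enorm (delta_mx 0 0 : 'rV[R]_n.+1) == 1.
Proof.
rewrite /enorm /dot (bigD1 0)//= big1 => [|i i0]; last by rewrite mxE (negbTE i0) andbF mul0r.
by rewrite mxE !eqxx mulr1 addr0 sqrtr1.
Qed.

(** The direction of v; the base point serves as a default value at v = 0. *)
Definition normalize v : sphere R n := insubd (Sphere sphere_base_subproof) ((enorm v)^-1 *: v).

Lemma dot_gt0 v : v != 0 -> 0 < dot v v.
Proof.
by move=> v0; rewrite lt_neqAle dot_ge0 andbT eq_sym; apply: contra v0 => /eqP/dot_eq0->.
Qed.

Lemma enorm_gt0 v : v != 0 -> 0 < enorm v.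
Proof. by move=> /dot_gt0; rewrite sqrtr_gt0. Qed.

Lemma svec_normalize v : v != 0 -> svec (normalize v) = (enorm v)^-1 *: v.
Proof.
move=> v0; have e0 := enorm_gt0 v0; rewrite /normalize /insubd insubT//=.
rewrite [X in X == _](_ : _ = 1) ?eqxx//.
rewrite /enorm dotZl dotZr -/(enorm v).
have -> : dot v v = enorm v * enorm v by rewrite -expr2 sqr_sqrtr ?dot_ge0.
by rewrite mulKf ?gt_eqF// mulVf ?gt_eqF// sqrtr1.
Qed.

Lemma normalizeN v : v != 0 -> normalize (- v) = antipode (normalize v).
Proof.
move=> v0; apply/val_inj; rewrite /= !svec_normalize ?oppr_eq0//.
by rewrite /enorm dotNl dotNr opprK scalerN.
Qed.

Lemma continuous_at_normalize (T : topologicalType) (g : T -> 'rV[R]_n.+1) t :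
  g t != 0 -> (forall i, {for t, continuous (fun s => g s 0 i)}) ->
  {for t, continuous (fun s => normalize (g s))}.
Proof.
move=> gt gc; apply: sphere_continuous_at => i.
have dotc : {for t, continuous (fun s => dot (g s) (g s))}.
  apply: (@continuous_at_sum R T _ _ _ (fun i s => g s 0 i * g s 0 i)) => j _.
  by apply: continuousM; exact: gc.
have ec : {for t, continuous (fun s => (enorm (g s))^-1 * g s 0 i)}.
  apply: continuousM; last exact: gc.
  apply: continuousV; first by rewrite gt_eqF// enorm_gt0.
  by apply: continuous_comp dotc _; exact: sqrt_continuous.
have : \forall s \near t, g s != 0.
  have /cvgr_gt/(_ 0) := dotc; move=> /(_ (dot_gt0 gt)); apply: filterS => s.
  by apply: contraTN => /eqP->; rewrite dot0l ltxx.
move=> gs; apply: continuous_at_near_eq ec; apply: filterS gs => s gs.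
by rewrite svec_normalize// mxE.
Qed.

End SphereTopology.

(** * No odd map below the threshold *)

(** Let g be the inner product. The matrix M = sum_x w x x^T has trace 1, hence its
    squared entries, whose sum is that of w(x) w(y) g(x,y)^2, add up to at least
    1/(n+1). On the other hand, the sum of w(x) w(y) (1 - g(x,y)) (g(x,y) - c) is
    nonnegative, and equal to -c - sum w(x) w(y) g(x,y)^2 because the barycentre
    is 0. *)
Lemma jung (R : realType) n (s : seq (sphere R n)) (w : sphere R n -> R) (c : R) :
  (forall x, x \in s -> 0 <= w x) -> \sum_(x <- s) w x = 1 ->
  (forall i, \sum_(x <- s) w x * svec x 0 i = 0) ->
  (forall x y, x \in s -> y \in s -> c <= dot x y) -> c <= - 1 / n.+1%:R.
Proof.
move=> w0 w1 bary0 cle.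
pose g (x y : sphere R n) := dot x y.
pose M a b := \sum_(x <- s) w x * (svec x 0 a * svec x 0 b).
have sumg : \sum_(x <- s) \sum_(y <- s) w x * w y * g x y = 0.
  rewrite (eq_bigr (fun x => \sum_i (w x * svec x 0 i) * \sum_(y <- s) w y * svec y 0 i)).
    by apply: big1 => x _; apply: big1 => i _; rewrite bary0 mulr0.
  move=> x _; rewrite (eq_bigr (fun y => \sum_i (w x * svec x 0 i) * (w y * svec y 0 i))).
    by rewrite exchange_big/=; apply: eq_bigr => i _; rewrite mulr_sumr.
  by move=> y _; rewrite /g /dot mulr_sumr; apply: eq_bigr => i _; ring.
have sum1 : \sum_(x <- s) \sum_(y <- s) w x * w y = 1.
  by rewrite -w1; apply: eq_bigr => x _; rewrite -mulr_sumr w1 mulr1.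
have sumg2 : \sum_(x <- s) \sum_(y <- s) w x * w y * g x y ^+ 2 = \sum_a \sum_b M a b ^+ 2.
  pose G x y a b := w x * w y * (svec x 0 a * svec x 0 b * (svec y 0 a * svec y 0 b)).
  rewrite (eq_bigr (fun x => \sum_a \sum_b \sum_(y <- s) G x y a b)) => [|x _].
    rewrite exchange_big/=; apply: eq_bigr => a _; rewrite exchange_big/=; apply: eq_bigr => b _.
    rewrite expr2 /M mulr_suml; apply: eq_bigr => x _; rewrite mulr_sumr.
    by apply: eq_bigr => y _; rewrite /G; ring.
  rewrite (eq_bigr (fun y => \sum_a \sum_b G x y a b)) => [|y _].
    by rewrite exchange_big/=; apply: eq_bigr => a _; rewrite exchange_big.
  rewrite /g /dot expr2 mulr_suml mulr_sumr; apply: eq_bigr => a _.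
  by rewrite !mulr_sumr; apply: eq_bigr => b _; rewrite /G; ring.
have trM : \sum_a M a a = 1.
  rewrite -w1 /M exchange_big/=; apply: eq_bigr => x _.
  by rewrite -mulr_sumr -[X in _ * X]/(dot x x) svec_dot mulr1.
have sumM : 1 / n.+1%:R <= \sum_a \sum_b M a b ^+ 2.
  set k : R := n.+1%:R; have k0 : 0 < k by rewrite ltr0n.
  have : 0 <= \sum_a (M a a - 1 / k) ^+ 2 by apply: sumr_ge0 => a _; exact: sqr_ge0.
  rewrite (eq_bigr (fun a => M a a ^+ 2 - (2 / k) * M a a + 1 / k ^+ 2)) => [|a _]; last first.
    by field; rewrite gt_eqF.
  rewrite big_split/= sumrB -mulr_sumr trM sumr_const card_ord -[X in _ + X]mulr_natr -/k.
  rewrite (_ : 1 / k ^+ 2 * k = 1 / k); last by field; rewrite gt_eqF.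
  have : \sum_a M a a ^+ 2 <= \sum_a \sum_b M a b ^+ 2.
    apply: ler_sum => a _; rewrite (bigD1 a)//= lerDl; apply: sumr_ge0 => b _; exact: sqr_ge0.
  by rewrite mulr1; set t := k^-1; lra.
have key : 0 <= \sum_(x <- s) \sum_(y <- s) w x * w y * ((1 - g x y) * (g x y - c)).
  rewrite big_seq; apply: sumr_ge0 => x xs; rewrite big_seq; apply: sumr_ge0 => y ys.
  have /andP[_ g1] := sphere_dot_itv x y.
  by rewrite !mulr_ge0 ?w0 ?subr_ge0 ?cle.
have : \sum_(x <- s) \sum_(y <- s) w x * w y * ((1 - g x y) * (g x y - c)) =
    (1 + c) * 0 - c * 1 - \sum_a \sum_b M a b ^+ 2.
  rewrite (eq_bigr (fun x => (1 + c) * (\sum_(y <- s) w x * w y * g x y)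
      - c * (\sum_(y <- s) w x * w y) - \sum_(y <- s) w x * w y * g x y ^+ 2)) => [|x _].
    by rewrite !sumrB -!mulr_sumr sumg sum1 sumg2.
  by rewrite !mulr_sumr -!sumrB; apply: eq_bigr => y _; ring.
move=> keyE; move: key sumM; rewrite keyE mulN1r mul1r.
by move: (\sum_a _) n.+1%:R^-1 => S t; lra.
Qed.

Lemma open_VRE (R : realType) (X : metricType R) r (A : set (VR X r)) :
  open A = realization_open A.
Proof. by []. Qed.

Section Centroid.
Variables (R : realType) (n : nat) (r : R).
Implicit Types p : VR (sphere R n) r.

Definition centroid p i : R := \sum_(v <- finsupp (bary p)) bary p v * svec v 0 i.

Lemma centroidE p (s : {fset sphere R n}) i : (finsupp (bary p) `<=` s)%fset ->
  centroid p i = \sum_(v <- s) bary p v * svec v 0 i.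
Proof.
move=> ps; apply: big_fset_incl => // v _ vp.
by rewrite fsfun_dflt// mul0r.
Qed.

(** On a closed simplex with vertices s the barycentre is a sum of #|s| terms, each of
    which is 1-Lipschitz in its barycentric coordinate. *)
Lemma centroid_continuous i : continuous (fun p => centroid p i).
Proof.
apply/continuousP => A Aopen; rewrite open_VRE => s Ks p Ap ps.
have /nbhs_ballP[e /= e0 eA] : nbhs (centroid p i) A by exact: open_nbhs_nbhs.
exists (e / (size s).+1%:R); first by rewrite divr_gt0.
move=> q qs pq; apply: eA; rewrite /ball/= !(@centroidE _ s)// -sumrB.
under eq_bigr do rewrite -mulrBl.
apply: le_lt_trans (ler_norm_sum _ _ _) _.
apply: (@le_lt_trans _ _ (\sum_(v <- s) e / (size s).+1%:R)).
  apply: ler_sum => v _; rewrite normrM -[leRHS]mulr1 ler_pM//; first exact: ltW.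
  have := coord_sqr_le_dot v i; rewrite svec_dot -real_normK ?num_real// -[leRHS](expr1n _ 2).
  by rewrite ler_sqr ?nnegrE.
rewrite big_const_seq count_predT iter_addr_0 -[ltLHS]mulr_natr -mulrA gtr_pMr//.
by rewrite mulrC ltr_pdivrMr ?ltr0n// mul1r ltr_nat.
Qed.

Lemma centroid_opp p i : centroid (VR_sphere_opp p) i = - centroid p i.
Proof.
rewrite /centroid /= finsupp_opp_coord; last exact: antipodeK.
rewrite big_imfset/=; last by move=> x y _ _; exact: (inv_inj (@antipodeK R n)).
rewrite -sumrN; apply: eq_bigr => x _; rewrite opp_coordE; last exact: antipodeK.
by rewrite antipodeK mxE mulrN.
Qed.

End Centroid.

Lemma acos_simplex_itv (R : realType) n : - 1 <= (- 1 / n.+1%:R : R) <= 1.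
Proof.
rewrite mulN1r lerN2 invf_le1 ?ltr0n// ler1n/=.
by apply: le_trans (_ : 0 <= 1)%R => //; rewrite oppr_le0 invr_ge0.
Qed.

Lemma no_odd_map_below (R : realType) n (r : R) (f : sphere R n.+1 -> VR (sphere R n) r) :
  0 <= r -> r < r_ R n -> ~ odd_map f.
Proof.
move=> r0 rrn [fc fodd].
pose F i z := centroid (f (normalize z)) i.
have [i z z0|i z z0|z z0 Fz] := @borsuk_ulam R n.+1 F.
- apply: (@continuous_comp _ _ _ (f \o @normalize R n.+1) (fun p => centroid p i));
    last exact: centroid_continuous.
  apply: continuous_comp; last exact: fc.
  by apply: (@continuous_at_normalize _ _ _ id) => // j; exact: coord_continuous.
- by rewrite /F normalizeN// fodd centroid_opp.
have rpi : r <= pi by apply/(le_trans (ltW rrn)); rewrite acos_lepi// acos_simplex_itv.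
set p := f (normalize z) in Fz.
have [[p0 pr] pge0 p1] := baryP p.
have : cos r <= - 1 / n.+1%:R.
  apply: (jung (s := finsupp (bary p)) (w := bary p)) => // x y xp yp.
  by rewrite -geodesic_le//; exact: (diam_fset_le r p0).1.
have h := @acos_simplex_itv R n; have := h; rewrite -[X in cos r <= X]acosK ?in_itv//=.
move=> _; rewrite leNgt ltr_cos ?in_itv/= ?acos_ge0 ?acos_lepi ?r0//.
by move: rrn; rewrite /r_ => ->.
Qed.

(** * A loop of inscribed regular simplices *)

Section Helmert.
Variables (R : rcfType) (n : nat).

(** The columns are those of the Helmert matrix up to a factor: they are orthogonal
    to each other and to the constant vector. After scaling, the rows become the vertices
    of a regular simplex. *)
Definition helmert_entry (i j : nat) : R :=
  if (i <= j)%N then -1 else if i == j.+1 then j.+1%:R else 0.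

(** Column j is constant on its first j + 1 entries, compensated by the next one. A
    single summation rule thus covers the sum of a column, the inner product of two
    columns and the norm of a column. *)
Lemma sum_helmert_entry j (F : nat -> R) : (j < n.+1)%N ->
  (forall i, (i <= j)%N -> F i = F 0%N) ->
  \sum_(i < n.+2) helmert_entry i j * F i = j.+1%:R * (F j.+1 - F 0%N).
Proof.
move=> jn FE; rewrite -(big_mkord xpredT (fun i => helmert_entry i j * F i)).
rewrite (big_cat_nat (n := j.+1))//= 1?ltnW// [X in _ + X]big_ltn//=.
rewrite (eq_big_nat _ _ (F2 := fun=> - F 0%N)) => [|i /andP[_ +]]; last first.
  by rewrite ltnS => ij; rewrite /helmert_entry ij mulN1r FE.
rewrite [X in _ + (_ + X)](eq_big_nat _ _ (F2 := fun=> 0)) ?big1_eq => [|i /andP[ji _]]; last first.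
  by rewrite /helmert_entry leqNgt (ltnW ji)/= gtn_eqF// mul0r.
rewrite sumr_const_nat subn0 /helmert_entry ltnn eqxx addr0 -mulr_natl; ring.
Qed.

Definition helmert_scale (j : nat) : R := Num.sqrt (n.+2%:R / (n.+1%:R * j.+1%:R * j.+2%:R)).

Definition simplex_mx : 'M[R]_(n.+2, n.+1) :=
  \matrix_(i, j) (helmert_scale j * helmert_entry i j).

Lemma simplex_mx_sum j : \sum_i simplex_mx i j = 0.
Proof.
under eq_bigr do rewrite mxE -[helmert_entry _ _]mulr1.
by rewrite -mulr_sumr (@sum_helmert_entry j (fun=> 1))// subrr !mulr0.
Qed.

Lemma simplex_mx_frame : simplex_mx^T *m simplex_mx = (n.+2%:R / n.+1%:R)%:M.
Proof.
have ortho (j k : 'I_n.+1) : (j < k)%N -> \sum_i simplex_mx i j * simplex_mx i k = 0.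
  move=> jk; rewrite (eq_bigr (fun i : 'I_n.+2 => (helmert_scale j * helmert_scale k) *
      (helmert_entry i j * helmert_entry i k))) => [|i _]; last by rewrite !mxE; ring.
  rewrite -mulr_sumr (@sum_helmert_entry j (fun i => helmert_entry i k))//.
    by rewrite /helmert_entry jk subrr !mulr0.
  by move=> i ij; rewrite /helmert_entry (leq_trans ij (ltnW jk)).
apply/matrixP => j k; rewrite !mxE; under eq_bigr do rewrite [_^T _ _]mxE.
case: (ltngtP j k) => [jk|kj|/val_inj <-].
- by rewrite ortho// -val_eqE ltn_eqF.
- under eq_bigr do rewrite mulrC.
  by rewrite ortho// -val_eqE gtn_eqF.
rewrite eqxx mulr1n (eq_bigr (fun i : 'I_n.+2 => helmert_scale j ^+ 2 *
    (helmert_entry i j * helmert_entry i j))) => [|i _]; last by rewrite !mxE; ring.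
rewrite -mulr_sumr (@sum_helmert_entry j (fun i => helmert_entry i j))//; last first.
  by move=> i ij; rewrite /helmert_entry ij.
rewrite /helmert_entry ltnn eqxx sqr_sqrtr; last first.
  by rewrite divr_ge0// !mulr_ge0.
rewrite leq0n opprK -[j.+2%:R]natr1.
have n0 : n.+1%:R != 0 :> R by rewrite pnatr_eq0.
have j0 : j.+1%:R != 0 :> R by rewrite pnatr_eq0.
have j1 : j.+1%:R + 1 != 0 :> R by rewrite natr1 pnatr_eq0.
move: n0 j0 j1; move: (n.+2%:R) (n.+1%:R) (j.+1%:R) => x y z *.
by field; apply/and3P.
Qed.

(** With a constant column added, the scaled matrix is square with orthonormal columns,
    and hence has orthonormal rows. *)
Lemma simplex_mx_gram i k : (simplex_mx *m simplex_mx^T) i k =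
  if i == k then 1 else - 1 / n.+1%:R.
Proof.
set g : R := n.+2%:R / n.+1%:R.
have n1 : 0 < n.+1%:R :> R by rewrite ltr0n.
have n2 : 0 < n.+2%:R :> R by rewrite ltr0n.
have g0 : 0 < g by rewrite divr_gt0.
pose a := (Num.sqrt n.+2%:R)^-1 : R; pose b := (Num.sqrt g)^-1 : R.
have aa : a * a = n.+2%:R^-1 by rewrite -invfM -expr2 sqr_sqrtr// ltW.
have bb : b * b = g^-1 by rewrite -invfM -expr2 sqr_sqrtr// ltW.
pose H : 'M[R]_(n.+2, 1 + n.+1) := row_mx (const_mx a) (b *: simplex_mx).
have trZ : (b *: simplex_mx)^T = b *: simplex_mx^T by rewrite linearZ.
have HH : H^T *m H = 1%:M.
  rewrite tr_row_mx mul_col_row trZ -!scalemxAl -!scalemxAr simplex_mx_frame.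
  have zero : (const_mx a)^T *m simplex_mx = 0 :> 'M[R]_(1, n.+1).
    apply/matrixP => i0 j; rewrite mxE [RHS]mxE.
    rewrite (eq_bigr (fun l => a * simplex_mx l j)) => [|l _]; last by rewrite !mxE.
    by rewrite -mulr_sumr simplex_mx_sum mulr0.
  have zero' : simplex_mx^T *m const_mx a = 0 :> 'M[R]_(n.+1, 1).
    by rewrite -[LHS]trmxK trmx_mul trmxK zero trmx0.
  rewrite zero zero' !scaler0.
  rewrite !scale_scalar_mx mulrA bb mulVf ?gt_eqF//.
  rewrite (_ : _ *m _ = 1%:M) ?scalar_mx_block//.
  apply/matrixP => i0 j0; rewrite !ord1 !mxE.
  rewrite (eq_bigr (fun=> n.+2%:R^-1)) => [|l _]; last by rewrite !mxE aa.
  by rewrite sumr_const card_ord -[LHS]mulr_natr mulVf ?(gt_eqF n2)// eqxx.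
have := mulmx1C HH; rewrite tr_row_mx mul_row_col trZ -scalemxAl -scalemxAr scalerA bb.
move=> /matrixP/(_ i k) e.
have -> : (simplex_mx *m simplex_mx^T) i k = g * ((i == k)%:R - n.+2%:R^-1).
  move: simplex_mx e => T; rewrite !mxE big_ord1 !mxE aa => <-.
  by rewrite addrAC subrr add0r mulVKf ?gt_eqF.
rewrite /g; move: n1 n2; rewrite -[n.+2%:R]natr1.
by move: n.+1%:R => z z0 z1; case: eqP => _ /=; field; rewrite !gt_eqF.
Qed.

(** In odd dimension n + 1 the map -1 has determinant -1, so that no path of rotations
    joins it to the identity. Such a path exists for its product with the reflection that
    exchanges two vertices, which also maps the simplex to its antipode. *)
Definition swap_vertices : 'S_n.+2 := if odd n.+1 then tperm 0 1 else 1%g.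

Lemma swap_verticesK : involutive swap_vertices.
Proof. by move=> k; rewrite /swap_vertices; case: ifP => _; rewrite ?perm1 ?tpermK. Qed.

Definition fixed_axis : 'M[R]_n.+1 := (odd n.+1)%:R *: delta_mx 0 0.

(** The first coordinate is nonzero at the first two vertices only, where it has
    opposite values; the other coordinates of these two vertices agree. *)
Lemma simplex_mx_reflect : simplex_mx *m (1%:M - 2 *: fixed_axis) = row_perm swap_vertices simplex_mx.
Proof.
rewrite /fixed_axis /swap_vertices; case: ifP => _; last first.
  by rewrite scale0r scaler0 subr0 mulmx1 row_perm1.
rewrite scale1r mulmxBr mulmx1 -scalemxAr; apply/matrixP => i j; rewrite !mxE.
rewrite (bigD1 0)//= big1 => [|k k0]; last by rewrite !mxE (negbTE k0) mulr0.
rewrite !mxE eqxx/= addr0.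
have [->|j0] := eqVneq j 0; rewrite /= ?mulr0 ?mulr1 ?subr0.
  case: tpermP => [->|->|/eqP i0 /eqP i1]; rewrite /helmert_entry /=; try ring.
  rewrite leqn0 (_ : (i == 0 :> nat) = false) 1?(_ : (i == 1 :> nat) = false); first ring.
    by apply/negbTE; apply: contra i1 => /eqP i1; apply/eqP/val_inj.
  by apply/negbTE; apply: contra i0 => /eqP i0; apply/eqP/val_inj.
case: tpermP => [->|->|//]; rewrite /helmert_entry /= lt0n.
  by rewrite -(val_eqE j) /= in j0 *; rewrite j0.
by rewrite -(val_eqE j) /= in j0 *; rewrite j0.
Qed.

(** A complex structure that pairs consecutive coordinates, starting with the last
    two. In odd dimension coordinate 0 is left over. *)
Definition rotation_gen : 'M[R]_n.+1 := \matrix_(i, j)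
  (((j == i.+1 :> nat) && odd (i + n))%:R - ((i == j.+1 :> nat) && odd (j + n))%:R).

Lemma rotation_gen_skew : rotation_gen^T = - rotation_gen.
Proof. by apply/matrixP => i j; rewrite !mxE opprB. Qed.

Lemma rotation_gen_axis : fixed_axis *m rotation_gen = 0.
Proof.
rewrite /fixed_axis -scalemxAl; apply/matrixP => i j; rewrite !mxE.
rewrite (bigD1 0)//= big1 ?addr0 => [|k k0]; last by rewrite !mxE (negbTE k0) andbF mul0r.
by rewrite !mxE/= add0n; case: (odd n); rewrite /= ?andbF ?subrr ?mulr0 ?mul0r.
Qed.

Lemma rotation_gen_sqr : rotation_gen *m rotation_gen^T = 1%:M - fixed_axis.
Proof.
pose partner (i : nat) := if odd (i + n) then i.+1 else i.-1.
pose sgn (i : nat) : R := if odd (i + n) then 1 else if i == 0%N then 0 else - 1.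
have JE (i j : 'I_n.+1) : rotation_gen i j = sgn i * (j == partner i :> nat)%:R.
  rewrite mxE /sgn /partner; case: (nat_of_ord i) (nat_of_ord j) => [|a] b.
    rewrite [X in _ - X](_ : _ = 0)// subr0; case: (odd _); rewrite ?andbT ?andbF ?mul1r ?mul0r//.
  case oa: (odd (a.+1 + n)).
    rewrite andbT mul1r; case: (eqVneq a.+1 b.+1) => [[<-]|_]; rewrite /= ?subr0//.
    by move: oa; rewrite addSn /= => /negbTE ->; rewrite subr0.
  rewrite andbF sub0r mulN1r eqSS /=; congr (- _%:R).
  rewrite eq_sym; case: (eqVneq b a) => [->|//]; move: oa; rewrite addSn /=.
  by move=> /negbFE ->.
have sum_partner (a b : nat) : (a < n.+1)%N ->
    \sum_(k < n.+1) (k == a :> nat)%:R * (k == b :> nat)%:R = (a == b)%:R :> R.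
  move=> an; rewrite (bigD1 (Ordinal an))//= big1 => [|k ka].
    by rewrite eqxx mul1r addr0.
  by rewrite (_ : (k == a :> nat) = false) ?mul0r//; apply/negbTE.
apply/matrixP => i k; rewrite mxE.
under eq_bigr => j _ do rewrite [_^T _ _]mxE !JE mulrACA.
rewrite -mulr_sumr /fixed_axis !mxE sum_partner; last first.
  rewrite /partner; have := ltn_ord i; move: (nat_of_ord i) => a an.
  by case: ifP => oa; lia.
rewrite -!val_eqE /= /sgn /partner; move: (nat_of_ord i) (nat_of_ord k) => a b.
case oa: (odd (a + n)); case ob: (odd (b + n)); case: (eqVneq a 0%N) => a0;
  case: (eqVneq b 0%N) => b0; case: (eqVneq a b) => ab; case on: (odd n); case: eqP => pab;
  rewrite /= ?mulr1n ?mulr0n; try ring; exfalso; lia.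
Qed.

Implicit Types v : 'rV[R]_2.

Definition rotation v : 'M[R]_n.+1 :=
  fixed_axis + v 0 0 *: (1%:M - fixed_axis) + v 0 1 *: rotation_gen.

Lemma fixed_axis_idem : fixed_axis *m fixed_axis = fixed_axis.
Proof.
rewrite /fixed_axis -scalemxAl -scalemxAr scalerA mul_delta_mx.
by case: odd; rewrite ?mul0r ?mul1r.
Qed.

Lemma tr_fixed_axis : fixed_axis^T = fixed_axis.
Proof. by rewrite /fixed_axis linearZ/= trmx_delta. Qed.

Lemma rotation_gen_axisr : rotation_gen *m fixed_axis = 0.
Proof.
apply: trmx_inj; rewrite trmx_mul tr_fixed_axis rotation_gen_skew mulmxN.
by rewrite rotation_gen_axis oppr0 trmx0.
Qed.

Lemma rotation_orthogonal v : v 0 0 ^+ 2 + v 0 1 ^+ 2 = 1 ->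
  rotation v *m (rotation v)^T = 1%:M.
Proof.
move=> v1; set E := fixed_axis; set J := rotation_gen; pose Q : 'M[R]_n.+1 := 1%:M - E.
have EE : E *m E = E := fixed_axis_idem.
have EJ : E *m J = 0 := rotation_gen_axis.
have JE : J *m E = 0 := rotation_gen_axisr.
have EQ : E *m Q = 0 by rewrite mulmxBr mulmx1 EE subrr.
have QE : Q *m E = 0 by rewrite mulmxBl mul1mx EE subrr.
have QQ : Q *m Q = Q by rewrite {1}/Q mulmxBl mul1mx EQ subr0.
have QJ : Q *m J = J by rewrite mulmxBl mul1mx EJ subr0.
have JQ : J *m Q = J by rewrite mulmxBr mulmx1 JE subr0.
have JJ : J *m J = - Q.
  by rewrite /Q -rotation_gen_sqr rotation_gen_skew mulmxN opprK.
have -> : (rotation v)^T = E + v 0 0 *: Q - v 0 1 *: J.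
  have trQ : Q^T = Q by rewrite linearB/= trmx1 tr_fixed_axis.
  have trL (X Y Z : 'M[R]_n.+1) (a b : R) :
      (X + a *: Y + b *: Z)^T = X^T + a *: Y^T + b *: Z^T.
    by apply/matrixP => i j; rewrite !mxE.
  by rewrite /rotation trL trQ rotation_gen_skew tr_fixed_axis scalerN.
have QE1 : E + Q = 1%:M by rewrite addrC subrK.
rewrite /rotation -/E -/J -/Q; clearbody Q E J.
rewrite !(mulmxDl, mulmxDr, mulmxN) -!(scalemxAl, scalemxAr) EE EJ JE EQ QE QQ QJ JQ JJ.
rewrite !scaler0 !(addr0, add0r, subr0) !scalerA scalerN opprK.
rewrite [v 0 1 * v 0 0]mulrC addrA -(addrA E) subrK -addrA -scalerDl -!expr2 v1.
by rewrite scale1r.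
Qed.

Lemma rotationN v : rotation (- v) = - ((1%:M - 2 *: fixed_axis) *m rotation v).
Proof.
rewrite /rotation !mxE; have := rotation_gen_axis; have := fixed_axis_idem.
move: fixed_axis rotation_gen => E J EE EJ.
have -> : (1%:M - 2 *: E) *m (E + v 0 0 *: (1%:M - E) + v 0 1 *: J) =
    (E + v 0 0 *: (1%:M - E) + v 0 1 *: J) - 2 *: E.
  rewrite mulmxBl mul1mx -scalemxAl !mulmxDr -!scalemxAr mulmxBr mulmx1 EE EJ subrr.
  by rewrite !scaler0 !addr0.
by apply/matrixP => i j; rewrite !mxE; ring.
Qed.

(** For v in the unit circle, [rotation v] is multiplication by the complex number v,
    except on the fixed axis where it is the identity. *)
Definition simplex_loop v : 'M[R]_(n.+2, n.+1) := simplex_mx *m rotation v.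

Lemma simplex_loop_affine : exists A B C : 'M[R]_(n.+2, n.+1),
  forall v k j, simplex_loop v k j = A k j + v 0 0 * B k j + v 0 1 * C k j.
Proof.
exists (simplex_mx *m fixed_axis), (simplex_mx *m (1%:M - fixed_axis)), (simplex_mx *m rotation_gen).
move=> v k j; rewrite /simplex_loop /rotation.
move: simplex_mx rotation_gen fixed_axis (1%:M - fixed_axis) => T J E Q.
rewrite !mulmxDr -!scalemxAr; move: (T *m Q) (T *m E) (T *m J) => TQ TE TJ.
by rewrite !mxE.
Qed.

Lemma simplex_loop_gram v i k : v 0 0 ^+ 2 + v 0 1 ^+ 2 = 1 ->
  (simplex_loop v *m (simplex_loop v)^T) i k = if i == k then 1 else - 1 / n.+1%:R.
Proof.
move=> v1; rewrite /simplex_loop trmx_mul mulmxA -(mulmxA simplex_mx).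
by rewrite rotation_orthogonal// mulmx1 simplex_mx_gram.
Qed.

Lemma simplex_loop_frame v : v 0 0 ^+ 2 + v 0 1 ^+ 2 = 1 ->
  (simplex_loop v)^T *m simplex_loop v = (n.+2%:R / n.+1%:R)%:M.
Proof.
move=> v1; rewrite /simplex_loop trmx_mul mulmxA -(mulmxA _ simplex_mx^T).
rewrite simplex_mx_frame mul_mx_scalar -scalemxAl mulmx1C ?rotation_orthogonal//.
by rewrite scalemx1.
Qed.

Lemma simplex_loop_sum v j : \sum_i simplex_loop v i j = 0.
Proof.
under eq_bigr do rewrite mxE.
rewrite exchange_big big1// => k _.
by rewrite -mulr_suml simplex_mx_sum mul0r.
Qed.

Lemma simplex_loopN v k j : simplex_loop (- v) k j = - simplex_loop v (swap_vertices k) j.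
Proof.
rewrite /simplex_loop rotationN mulmxN mulmxA simplex_mx_reflect row_permE -mulmxA.
by rewrite -row_permE mxE [in LHS]mxE.
Qed.

End Helmert.

(** * From families of finite measures to Vietoris-Rips complexes *)

Lemma dot_continuous_at (R : realType) n (T : topologicalType) (f g : T -> 'rV[R]_n.+1) t :
  (forall i, {for t, continuous (fun s => f s 0 i)}) ->
  (forall i, {for t, continuous (fun s => g s 0 i)}) ->
  {for t, continuous (fun s => dot (f s) (g s))}.
Proof.
move=> fc gc; apply: (@continuous_at_sum R T _ _ _ (fun i s => f s 0 i * g s 0 i)) => i _.
by apply: continuousM; [exact: fc|exact: gc].
Qed.

(** A finite subcover of the compact unit sphere, made symmetric. *)
Lemma sphere_net (R : realType) n (e : R) : 0 < e -> e <= pi ->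
  exists N : {fset sphere R n}, (forall y, y \in N -> antipode y \in N) /\
    forall x, exists2 y, y \in N & geodesic x y < e.
Proof.
move=> e0 epi.
pose box := [set v : 'rV[R]_n.+1 | forall b, `[-1, 1]%classic (v ord0 b)].
have box_compact : compact box.
  by apply: (@rV_compact R n.+1 (fun=> `[-1, 1]%classic)) => b; exact: segment_compact.
pose A := [set v : 'rV[R]_n.+1 | dot v v = 1].
have dotc (f g : 'rV[R]_n.+1 -> 'rV[R]_n.+1) :
    (forall i, continuous (fun v => f v 0 i)) -> (forall i, continuous (fun v => g v 0 i)) ->
    continuous (fun v => dot (f v) (g v)).
  by move=> fc gc v; apply: dot_continuous_at => i; [exact: fc|exact: gc].
have A_compact : compact A.
  apply: (subclosed_compact _ box_compact).
    apply: (@preimage_closed _ _ (fun v : 'rV[R]_n.+1 => dot v v) [set t | t = 1]); last exact: closed_eq.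
    by move=> v _; apply: (dotc id id) => i w; exact: coord_continuous.
  move=> v v1 b /=; rewrite in_itv/= -ler_norml -ler_sqr ?nnegrE// expr1n.
  by rewrite real_normK ?num_real// -v1 coord_sqr_le_dot.
move: A_compact; rewrite compact_cover.
move=> /(_ (sphere R n) setT (fun y => [set v | cos e < dot v (svec y)])) [||D _ DA].
- move=> y _; apply: (@open_comp _ _ (fun v : 'rV[R]_n.+1 => dot v (svec y)) [set t | cos e < t]).
    move=> v _; apply: (dotc id (fun=> svec y)) => i w; first exact: coord_continuous.
    exact: cst_continuous.
  exact: open_gt.
- move=> v v1; have v0 : v != 0 by apply/eqP => v0; move: v1; rewrite v0 /A/= dot0l => /eqP; rewrite eq_sym oner_eq0.
  exists (normalize v) => //=; rewrite svec_normalize// /enorm v1 sqrtr1 invr1 scale1r v1.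
  by rewrite -cos0 ltr_cos ?in_itv/= ?lexx ?pi_ge0 ?(ltW e0).
exists (D `|` [fset antipode y | y in D])%fset; split.
  move=> y; rewrite !inE => /orP[yD|/imfsetP[x /= xD ->]].
    by apply/orP; right; exact: in_imfset.
  by rewrite antipodeK xD.
move=> x; have [|y /= yD xy] := DA (svec x); first exact: svec_dot.
by exists y; rewrite ?inE ?yD// geodesic_lt.
Qed.

(** Near t the support of [g t] can only grow, and there are finitely many simplices
    with vertices in Y: the coherent topology imposes finitely many conditions. *)
Lemma VR_continuous (R : realType) (X : metricType R) (r : R) (T : topologicalType)
    (g : T -> VR X r) (Y : {fset X}) :
  (forall t, (finsupp (bary (g t)) `<=` Y)%fset) ->
  (forall y, y \in Y -> continuous (fun t => bary (g t) y)) -> continuous g.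
Proof.
move=> gY gc; apply/continuousP => A; rewrite open_VRE => Aopen.
rewrite openE => t At; rewrite /interior/=.
have near_Y (P : X -> T -> Prop) : (forall y, y \in Y -> \forall q \near t, P y q) ->
    \forall q \near t, forall y, y \in Y -> P y q.
  move=> PY; have PtY : nbhs t (\bigcap_(y in [set` Y]) P y) by exact: filter_bigI.
  by apply: filterS PtY => q qP y yY; exact: qP.
have /choice[e eP] (s : {fset X}) : exists e : R, 0 < e /\
    (simplices (VR_complex X r) s -> (finsupp (bary (g t)) `<=` s)%fset ->
     forall q, (finsupp (bary q) `<=` s)%fset -> (forall v, `|bary (g t) v - bary q v| < e) -> A q).
  have [[Ks ts]|no] := pselect (simplices (VR_complex X r) s /\ (finsupp (bary (g t)) `<=` s)%fset).
    by have [e e0 eA] := Aopen s Ks _ At ts; exists e.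
  by exists 1; split=> // Ks ts; case: no.
pose E := \big[Num.min/1]_(s <- fpowerset Y) e s.
have E0 : 0 < E by rewrite /E; apply: (big_ind (fun x => 0 < x)) => // [a b a0 b0|s _]; [rewrite lt_min a0|case: (eP s)].
have near_supp : \forall q \near t, forall y, y \in Y -> 0 < bary (g t) y -> 0 < bary (g q) y.
  apply: near_Y => y yY; have [ty|ty] := ltP 0 (bary (g t) y).
    by have /cvgr_gt/(_ _ ty) := gc y yY t; apply: filterS.
  by apply: nearW => q.
have near_dist : \forall q \near t, forall y, y \in Y -> `|bary (g t) y - bary (g q) y| < E.
  by apply: near_Y => y yY; have /cvgrPdist_lt/(_ _ E0) := gc y yY t.
move: near_supp near_dist; apply: filterS2 => q q_supp q_dist.
have ts : (finsupp (bary (g t)) `<=` finsupp (bary (g q)))%fset.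
  apply/fsubsetP => y yt; rewrite mem_finsupp gt_eqF//.
  apply: q_supp; first exact: (fsubsetP (gY t)).
  have [_ /(_ y) y0 _] := baryP (g t).
  by rewrite lt_neqAle y0 eq_sym -mem_finsupp yt.
have [_ /(_ _ ts)] := eP (finsupp (bary (g q))); apply => //; first by have [] := baryP (g q).
move=> v; have [vY|vY] := boolP (v \in Y); last first.
  rewrite !fsfun_dflt ?subrr ?normr0; first by case: (eP (finsupp (bary (g q)))).
    by apply: contra vY; exact: (fsubsetP (gY q)).
  by apply: contra vY; exact: (fsubsetP (gY t)).
apply: lt_le_trans (q_dist v vY) _.
by apply: (@bigmin_inf_seq _ _ _ _ _ (finsupp (bary (g q)))); rewrite // fpowersetE.
Qed.

Lemma continuous_at_mul0 (R : realType) (T : topologicalType) (f g : T -> R) (M : R) t :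
  {for t, continuous f} -> (forall s, `|g s| <= M) ->
  (f t != 0 -> {for t, continuous g}) -> {for t, continuous (fun s => f s * g s)}.
Proof.
move=> fc gM gc; have [f0|/gc {}gc] := eqVneq (f t) 0; last exact: continuousM.
have M1 : 0 < M + 1 by rewrite ltr_wpDl// (le_trans _ (gM t)).
apply/cvgrPdist_lt => e e0; rewrite f0 mul0r.
have /cvgrPdist_lt/(_ _ (divr_gt0 e0 M1)) := fc; rewrite f0.
apply: filterS => s; rewrite !sub0r !normrN normrM ltr_pdivlMr// => fs.
apply: le_lt_trans fs; rewrite ler_wpM2l// (le_trans (gM s))// lerDl//.
Qed.

(** The measure with masses [mass p i] at the points [site p i] is replaced by the one
    with weight W p y = sum_i mass p i * phi (site p i) y at each point y of a net, where
    phi is a bump function supported in a ball of radius e with 2 e <= r - r0. Sites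
    without mass are allowed to jump, and only sites with a mass have to be antipodal. *)
Lemma odd_map_of_masses (R : realType) k n (I : finType) (r0 r : R)
    (mass : sphere R k -> I -> R) (site : sphere R k -> I -> sphere R n)
    (tau : I -> I) :
  involutive tau -> r0 < r ->
  (forall p i, 0 <= mass p i) -> (forall p, exists i, 0 < mass p i) ->
  (forall i, continuous (mass^~ i)) ->
  (forall p i, 0 < mass p i -> {for p, continuous (site^~ i)}) ->
  (forall p i j, 0 < mass p i -> 0 < mass p j -> geodesic (site p i) (site p j) <= r0) ->
  (forall p i, mass (antipode p) i = mass p (tau i)) ->
  (forall p i, 0 < mass p i -> site (antipode p) (tau i) = antipode (site p i)) ->
  exists f : sphere R k -> VR (sphere R n) r, odd_map f.
Proof.
move=> tauK r0r mass_ge0 mass_ex mass_cont site_cont site_diam mass_odd site_odd.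
pose e := Num.min pi ((r - r0) / 2).
have e0 : 0 < e by rewrite lt_min pi_gt0 divr_gt0 ?subr_gt0.
have epi : e <= pi by rewrite ge_min lexx.
have er : e + e <= r - r0.
  have : e <= (r - r0) / 2 by rewrite ge_min lexx orbT.
  lra.
have [N [Nopp Nnet]] := sphere_net n e0 epi.
pose phi (x y : sphere R n) : R := Num.max 0 (dot x y - cos e).
have phi_ge0 x y : 0 <= phi x y by rewrite le_max lexx.
have phi_gt0 x y : (0 < phi x y) = (geodesic x y < e).
  by rewrite lt_max ltxx /= subr_gt0 geodesic_lt.
have phi_opp x y : phi (antipode x) y = phi x (antipode y).
  by rewrite /phi /= dotNl dotNr.
have phi_le x y : `|phi x y| <= 2.
  rewrite ger0_norm// ge_max ler0n/=.
  have /andP[_ xy] := sphere_dot_itv x y; have := cos_geN1 e; lra.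
pose W p y := \sum_i mass p i * phi (site p i) y.
have W_ge0 p y : 0 <= W p y by apply: sumr_ge0 => i _; rewrite mulr_ge0.
have W_gt0 p y : 0 < W p y -> exists2 i, 0 < mass p i & geodesic (site p i) y < e.
  move=> Wp; have /existsP[i /andP[mi gi]] : [exists i, (0 < mass p i) && (geodesic (site p i) y < e)].
    apply: contraLR Wp => /existsPn no; rewrite -leNgt /W big1// => i _.
    have := no i; rewrite negb_and -phi_gt0 -!leNgt => /orP[mi|gi].
      by rewrite (_ : mass p i = 0) ?mul0r//; apply/eqP; rewrite eq_le mi mass_ge0.
    by rewrite (_ : phi _ _ = 0) ?mulr0//; apply/eqP; rewrite eq_le gi phi_ge0.
  by exists i.
have W_opp p y : W (antipode p) y = W p (antipode y).
  rewrite /W (reindex_inj (inv_inj tauK)); apply: eq_bigr => i _.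
  rewrite mass_odd tauK; have [->|mi] := eqVneq (mass p i) 0; first by rewrite !mul0r.
  by rewrite site_odd ?phi_opp// lt_neqAle eq_sym mi mass_ge0.
have W_cont y : continuous (W^~ y).
  move=> p; apply: continuous_at_sum => i _.
  apply: (@continuous_at_mul0 _ _ _ _ 2); first exact: mass_cont.
    by move=> q; exact: phi_le.
  move=> mi; have {}mi : 0 < mass p i by rewrite lt_neqAle eq_sym mi mass_ge0.
  have sc := site_cont p i mi.
  have dc : {for p, continuous (fun q => dot (site q i) y)}.
    apply: dot_continuous_at => j; last exact: cst_continuous.
    by apply: (@continuous_comp _ _ _ (site^~ i) (fun x => svec x 0 j) p sc); exact: svec_continuous.
  apply: continuous_max; first exact: cst_continuous.
  by apply: continuousB => //; exact: cst_continuous.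
pose tot p := \sum_(y <- N) W p y.
have tot_cont : continuous tot by move=> p; apply: continuous_at_sum => y _; exact: W_cont.
have tot_gt0 p : 0 < tot p.
  have [i mi] := mass_ex p; have [y yN iy] := Nnet (site p i).
  rewrite /tot (big_fsetD1 y)//= ltr_wpDr ?sumr_ge0//.
  rewrite /W (bigD1 i)//= ltr_wpDr ?sumr_ge0// => [j _|]; first by rewrite mulr_ge0.
  by rewrite mulr_gt0// phi_gt0.
have tot_opp p : tot (antipode p) = tot p.
  have NE : [fset antipode y | y in N]%fset = N.
    apply/fsetP => y; apply/imfsetP/idP => [[x /= /Nopp xN ->//]|yN].
    by exists (antipode y); [exact: Nopp|rewrite antipodeK].
  rewrite /tot -[in LHS]NE big_imfset/=; last by move=> x y _ _; exact: (inv_inj (@antipodeK R n)).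
  by apply: eq_bigr => y _; rewrite W_opp antipodeK.
pose w p : {fsfun sphere R n -> R with 0} := [fsfun y in N => W p y / tot p | 0].
have wE p y : w p y = if y \in N then W p y / tot p else 0 by rewrite fsfunE.
have wN p : (finsupp (w p) `<=` N)%fset by exact: finsupp_sub.
have w1 p : \sum_(y <- finsupp (w p)) w p y = 1.
  rewrite (big_fset_incl _ (wN p))/= => [|y _ yw]; last exact: fsfun_dflt.
  rewrite big_seq (eq_bigr (fun y => W p y / tot p)) => [|y yN]; last by rewrite wE yN.
  by rewrite -big_seq -mulr_suml -/(tot p) divff// gt_eqF.
have w_bary p : `[< barycentric (VR_complex (sphere R n) r) (w p) >].
  apply/asboolP; have supp0 : finsupp (w p) != fset0.
    by apply/eqP => w0; have := w1 p; rewrite w0 big_seq_fset0 => /eqP; rewrite eq_sym oner_eq0.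
  split => //.
  - split => //; apply/(diam_fset_le _ supp0) => x y.
    rewrite !mem_finsupp !wE.
    case: ifP => _; last by rewrite eqxx.
    move=> Wx; case: ifP => _; last by rewrite eqxx.
    move=> Wy; have [i mi ix] : exists2 i, 0 < mass p i & geodesic (site p i) x < e.
      by apply: W_gt0; rewrite lt_neqAle W_ge0 andbT eq_sym; apply: contra Wx => /eqP->; rewrite mul0r.
    have [j mj jy] : exists2 i, 0 < mass p i & geodesic (site p i) y < e.
      by apply: W_gt0; rewrite lt_neqAle W_ge0 andbT eq_sym; apply: contra Wy => /eqP->; rewrite mul0r.
    have := site_diam p i j mi mj.
    have := metric_triangle x (site p i) y; have := metric_triangle (site p i) (site p j) y.
    have mE (a b : sphere R n) : mdist a b = geodesic a b by [].
    by rewrite (metric_sym x (site p i)) !mE; lra.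
  - by move=> y; rewrite wE; case: ifP => // _; rewrite divr_ge0// ltW.
exists (fun p => Realization (w_bary p)); split.
  apply: (@VR_continuous _ _ _ _ _ N) => [p|y yN] /=; first exact: wN.
  have -> : (fun p => w p y) = (fun p => W p y / tot p) by apply/funext => p; rewrite wE yN.
  move=> p; apply: (@continuousM _ _ (W^~ y) (fun p => (tot p)^-1) p); first exact: W_cont.
  by apply: continuousV; [rewrite gt_eqF|exact: tot_cont].
move=> p; apply/val_inj/fsfunP => y /=; rewrite opp_coordE; last exact: antipodeK.
rewrite !wE tot_opp W_opp (_ : (antipode y \in N) = (y \in N))//.
by apply/idP/idP => [/Nopp|/Nopp//]; rewrite antipodeK.
Qed.

(** * Odd maps above the threshold *)

Lemma dot_sumr (R : realType) n (I : Type) (s : seq I) (P : pred I)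
    (F : I -> 'rV[R]_n.+1) v :
  dot v (\sum_(i <- s | P i) F i) = \sum_(i <- s | P i) dot v (F i).
Proof. by rewrite (big_morph _ (dotDr v) (_ : _ = 0))// dotC dot0l. Qed.

Section SphereMap.
Variables (R : realType) (n : nat).
Local Notation SphereN2 := (sphere R (n + 2)).
Implicit Types (p q : SphereN2) (k l : 'I_n.+2).

Definition xpart p : 'rV[R]_n.+1 := lsubmx (svec p : 'rV_(n.+1 + 2)).
Definition ypart p : 'rV[R]_2 := rsubmx (svec p : 'rV_(n.+1 + 2)).

Lemma xpart_ypart_dot p : dot (xpart p) (xpart p) + dot (ypart p) (ypart p) = 1.
Proof.
rewrite -[RHS](svec_dot p) {3}/dot.
rewrite [RHS](@big_split_ord _ _ _ n.+1 2 xpredT (fun i => svec p 0 i * svec p 0 i)) /=.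
by congr (_ + _); apply: eq_bigr => i _; rewrite !mxE.
Qed.

Lemma ypart_cases p : ypart p = 0 \/ ypart p != 0.
Proof. by have [|] := eqVneq (ypart p) 0; [left|right]. Qed.

Lemma xpartN p : xpart (antipode p) = - xpart p.
Proof. by apply/rowP => i; rewrite !mxE. Qed.

Lemma ypartN p : ypart (antipode p) = - ypart p.
Proof. by apply/rowP => i; rewrite !mxE. Qed.

Lemma xpart_continuous i : continuous (fun p => xpart p 0 i).
Proof.
rewrite (_ : (fun p => _) = (fun p : SphereN2 => svec p 0 (lshift 2 i : 'I_(n.+1 + 2)))).
  exact: svec_continuous.
by apply/funext => p; rewrite mxE.
Qed.

Lemma ypart_continuous i : continuous (fun p => ypart p 0 i).
Proof.
rewrite (_ : (fun p => _) = (fun p : SphereN2 => svec p 0 (rshift n.+1 i : 'I_(n.+1 + 2)))).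
  exact: svec_continuous.
by apply/funext => p; rewrite mxE.
Qed.

(** At y = 0 the direction of y is a default value, on which nothing will depend. *)
Definition frame p k : 'rV[R]_n.+1 :=
  row k (simplex_loop n (svec (normalize (ypart p)))).

Let dir_unit p : (svec (normalize (ypart p))) 0 0 ^+ 2 + (svec (normalize (ypart p))) 0 1 ^+ 2 = 1.
Proof.
rewrite -[RHS](svec_dot (normalize (ypart p))) /dot big_ord_recl big_ord1 -!expr2.
by congr (_ + svec _ _ _ ^+ 2); apply/val_inj.
Qed.

Lemma frame_dot p k l : dot (frame p k) (frame p l) = if k == l then 1 else - 1 / n.+1%:R.
Proof.
rewrite -(simplex_loop_gram k l (dir_unit p)) mxE; apply: eq_bigr => i _.
by rewrite ![row _ _ _ _]mxE [_^T _ _]mxE.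
Qed.

Lemma frame_neq0 p k : frame p k != 0.
Proof.
apply/eqP => f0; have := frame_dot p k k; rewrite eqxx f0 dot0l => /eqP.
by rewrite eq_sym oner_eq0.
Qed.

Lemma normalize_frame p k : svec (normalize (frame p k)) = frame p k.
Proof.
by rewrite svec_normalize ?frame_neq0// /enorm frame_dot eqxx sqrtr1 invr1 scale1r.
Qed.

Lemma frame_sum p : \sum_k frame p k = 0.
Proof.
apply/rowP => j; rewrite summxE mxE -[RHS](simplex_loop_sum (svec (normalize (ypart p))) j).
by apply: eq_bigr => k _; rewrite mxE.
Qed.

Lemma frame_expand p x :
  \sum_k dot x (frame p k) *: frame p k = (n.+2%:R / n.+1%:R) *: x.
Proof.
set S := simplex_loop n (svec (normalize (ypart p))).
have -> : (n.+2%:R / n.+1%:R) *: x = x *m (S^T *m S).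
  by rewrite simplex_loop_frame// mul_mx_scalar.
rewrite mulmxA; apply/rowP => j; rewrite summxE mxE; apply: eq_bigr => k _.
rewrite !mxE; congr (_ * _); apply: eq_bigr => i _; rewrite !mxE//.
Qed.

Lemma frameN p k : ypart p != 0 -> frame (antipode p) k = - frame p (swap_vertices n k).
Proof.
move=> t0; apply/rowP => j; rewrite /frame ypartN normalizeN// mxE.
by rewrite [antipode _ : 'rV__]/= simplex_loopN !mxE.
Qed.

Lemma frame_continuous p k j : ypart p != 0 -> {for p, continuous (fun q => frame q k 0 j)}.
Proof.
move=> t0.
have vc i : {for p, continuous (fun q => svec (normalize (ypart q)) 0 i)}.
  apply: (@continuous_comp _ _ _ (fun q => normalize (ypart q)) (fun x => svec x 0 i));
    last exact: svec_continuous.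
  by apply: continuous_at_normalize => // l; exact: ypart_continuous.
have [A [B [C SE]]] := simplex_loop_affine R n.
have -> : (fun q => frame q k 0 j) = (fun q => A k j +
    svec (normalize (ypart q)) 0 0 * B k j + svec (normalize (ypart q)) 0 1 * C k j).
  by apply/funext => q; rewrite mxE SE.
apply: continuousD; last by apply: continuousM; [exact: vc|exact: cst_continuous].
apply: continuousD; first exact: cst_continuous.
by apply: continuousM; [exact: vc|exact: cst_continuous].
Qed.

(** Up to the factor (n+2)/(n+1) the x part of p is sum_k coef p k *: frame p k, and
    subtracting [low p] from all the coefficients does not change this sum. *)
Definition coef p k := dot (xpart p) (frame p k).
Definition low p := \big[Num.min/2]_k coef p k.
(** The threshold is at least 2, which bounds [coef p k - low p], near y = 0, and
    negative near x = 0, that is |y| = 1. *)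
Definition height p : R := 3 - 6 * dot (ypart p) (ypart p).
Definition level p k : R := Num.min (coef p k - low p) (height p).
Definition capped_sum p := \sum_k level p k *: frame p k.

Lemma coef_itv p k : -1 <= coef p k <= 1.
Proof.
have := cauchy_schwarz (xpart p) (frame p k); rewrite frame_dot eqxx mulr1 => cs.
have := xpart_ypart_dot p; have := dot_ge0 (ypart p) => t0 ht.
by rewrite -ler_norml -ler_sqr ?nnegrE// expr1n real_normK ?num_real//; rewrite /coef; lra.
Qed.

Lemma low_le p k : low p <= coef p k.
Proof. exact: bigmin_le. Qed.

Lemma lowP p : exists k, coef p k = low p.
Proof.
rewrite /low (@bigmin_eq_arg _ _ _ _ ord0)//; first by eexists.
by move=> k _; have := coef_itv p k; lra.
Qed.

Lemma coef_low_le2 p k : coef p k - low p <= 2.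
Proof.
have [l <-] := lowP p; have := coef_itv p k; have := coef_itv p l; lra.
Qed.

Lemma height_ypart0 p : ypart p = 0 -> height p = 3.
Proof. by rewrite /height => ->; rewrite dot0l; lra. Qed.

Lemma sum_coef p : \sum_k coef p k = 0.
Proof. by rewrite -dot_sumr frame_sum dotC dot0l. Qed.

(** Constant coefficients have sum 0, hence vanish; so x = 0 and |y| = 1. *)
Lemma height_coef_const p : (forall k, coef p k = low p) -> height p = -3.
Proof.
move=> cl; have n2 : n.+2%:R != 0 :> R by rewrite pnatr_eq0.
have n1 : n.+1%:R != 0 :> R by rewrite pnatr_eq0.
have low0 : low p = 0.
  have := sum_coef p; rewrite (eq_bigr (fun=> low p))// sumr_const card_ord.
  by move=> /eqP; rewrite -mulr_natr mulf_eq0 (negbTE n2) orbF => /eqP.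
have := frame_expand p (xpart p); rewrite big1 => [|k _]; last first.
  by rewrite -/(coef p k) cl low0 scale0r.
move=> /esym/eqP; rewrite scaler_eq0 mulf_eq0 invr_eq0 (negbTE n1) (negbTE n2)/= => /eqP h0.
have := xpart_ypart_dot p; rewrite h0 dot0l add0r /height => ->; lra.
Qed.

Lemma dot_frame_capped_sum p k :
  dot (frame p k) (capped_sum p) = level p k - (\sum_(l | l != k) level p l) / n.+1%:R.
Proof.
rewrite dot_sumr (bigD1 k)//= dotZr frame_dot eqxx mulr1; congr (_ + _).
rewrite mulr_suml -sumrN; apply: eq_bigr => l lk.
by rewrite dotZr frame_dot eq_sym (negbTE lk) mulN1r mulrN.
Qed.

(** The level of a vertex with the smallest coefficient is 0. If the sum vanished, then
    its inner product with this vertex would force all levels to be 0, and all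
    coefficients to be equal. *)
Lemma capped_sum_neq0 p : 0 < height p -> capped_sum p != 0.
Proof.
move=> h0; apply/eqP => c0; have [k0 k0E] := lowP p.
have t_ge0 l : 0 <= level p l by rewrite le_min subr_ge0 low_le ltW.
have tk0 : level p k0 = 0 by rewrite /level k0E subrr; apply/min_idPl/ltW.
have := dot_frame_capped_sum p k0; rewrite c0 dotC dot0l tk0 sub0r => /esym/eqP.
rewrite oppr_eq0 mulf_eq0 invr_eq0 pnatr_eq0 orbF psumr_eq0// => /allP t0.
have := @height_coef_const p; have : forall k, coef p k = low p.
  move=> k; have [->//|kk0] := eqVneq k k0.
  have := t0 k (mem_index_enum k); rewrite kk0/= => /eqP tk.
  apply/eqP; rewrite -subr_eq0; move: tk; rewrite /level; case: leP => _ hk.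
    by rewrite hk.
  by move: h0; rewrite hk ltxx.
move=> cl /(_ cl); lra.
Qed.

(** Vertex k has level h, the height, and the n + 1 other vertices, of levels at most h,
    have inner product -1/(n+1) with it. *)
Lemma dot_frame_capped_sum_ge0 p k : 0 < height p -> height p < coef p k - low p ->
  0 <= dot (frame p k) (capped_sum p).
Proof.
move=> h0 hk; rewrite dot_frame_capped_sum {1}/level (min_idPr (ltW hk)) subr_ge0 ler_pdivrMr ?ltr0n//.
apply: (@le_trans _ _ (\sum_(l | l != k) height p)).
  by apply: ler_sum => l _; rewrite ge_min lexx orbT.
rewrite sumr_const (_ : #|_| = n.+1) ?mulr_natr//.
by have := cardC1 k; rewrite card_ord.
Qed.

(** No coefficient is cut off: the sum no longer depends on the simplex. *)
Lemma capped_sum_xpart p : 2 <= height p -> capped_sum p = (n.+2%:R / n.+1%:R) *: xpart p.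
Proof.
move=> h2; have lowf : \sum_k low p *: frame p k = 0 by rewrite -scaler_sumr frame_sum scaler0.
have -> : capped_sum p = \sum_k coef p k *: frame p k - \sum_k low p *: frame p k.
  rewrite -sumrB; apply: eq_bigr => k _; rewrite -scalerBl.
  by congr (_ *: _); apply/min_idPl/(le_trans (coef_low_le2 p k)).
by rewrite lowf subr0 frame_expand.
Qed.

Lemma height_continuous : continuous height.
Proof.
move=> p; suff : {for p, continuous (fun q => 3 - 6 * dot (ypart q) (ypart q))} by [].
apply: continuousB; first exact: cst_continuous.
apply: continuousM; first exact: cst_continuous.
by apply: dot_continuous_at => i; exact: ypart_continuous.
Qed.

Lemma coef_continuous p k : ypart p != 0 -> {for p, continuous (fun q => coef q k)}.
Proof.
move=> t0; apply: dot_continuous_at => i; [exact: xpart_continuous|exact: frame_continuous].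
Qed.

Lemma low_continuous p : ypart p != 0 -> {for p, continuous low}.
Proof.
move=> t0.
have min_cont : continuous (fun z : R * R => Num.min z.1 z.2).
  by move=> z; apply: continuous_min; [exact: cvg_fst|exact: cvg_snd].
apply: (@cvg_big R _ Num.min 2 xpredT min_cont _ (nbhs p) _ (fun k q => coef q k)) => k _.
exact: coef_continuous.
Qed.

Lemma near_height_gt2 p : ypart p = 0 -> \forall q \near p, 2 < height q.
Proof.
move=> t0; have /cvgr_gt/(_ 2) := @height_continuous p.
by apply; rewrite height_ypart0//; lra.
Qed.

Lemma capped_sum_continuous p i : 0 < height p -> {for p, continuous (fun q => capped_sum q 0 i)}.
Proof.
move=> h0; have [t0|t0] := ypart_cases p.
  have hc : {for p, continuous (fun q => (n.+2%:R / n.+1%:R) * xpart q 0 i)}.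
    by apply: continuousM; [exact: cst_continuous|exact: xpart_continuous].
  have cE q : 2 < height q -> capped_sum q 0 i = (n.+2%:R / n.+1%:R) * xpart q 0 i.
    by move=> /ltW h2; rewrite capped_sum_xpart// mxE.
  by apply: continuous_at_near_eq hc; move: (near_height_gt2 t0); apply: filterS => q /cE.
have -> : (fun q => capped_sum q 0 i) = (fun q =>
    \sum_k level q k * frame q k 0 i).
  by apply/funext => q; rewrite summxE; apply: eq_bigr => k _; rewrite mxE.
apply: continuous_at_sum => k _; apply: continuousM; last exact: frame_continuous.
apply: continuous_min; last exact: height_continuous.
by apply: continuousB; [exact: coef_continuous|exact: low_continuous].
Qed.

(** The index [None] stands for the direction of the capped sum. *)
Definition mass p (i : option 'I_n.+2) : R :=
  if i is Some k then Num.max 0 (coef p k - low p - height p) else Num.max 0 (height p).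

Definition site p (i : option 'I_n.+2) : sphere R n :=
  if i is Some k then normalize (frame p k) else normalize (capped_sum p).

Definition swap (i : option 'I_n.+2) := omap (swap_vertices n) i.

Lemma swapK : involutive swap.
Proof. by case=> //= k; rewrite swap_verticesK. Qed.

Lemma mass_ge0 p i : 0 <= mass p i.
Proof. by case: i => [k|]; rewrite /= le_max lexx. Qed.

(** If h <= 0 and no vertex has a mass, then 0 <= coef p k - low p <= h for all k: so
    h = 0 and all the coefficients are equal, which requires h = -3. *)
Lemma mass_ex p : exists i, 0 < mass p i.
Proof.
have [h0|h0] := ltP 0 (height p); first by exists None; rewrite /= lt_max h0 orbT.
have [k hk|no] := pickP (fun k => height p < coef p k - low p).
  by exists (Some k); rewrite /= lt_max subr_gt0 hk orbT.
have cl k : coef p k - low p = height p /\ coef p k = low p.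
  have := no k; have := low_le p k; case: ltP => // ah lk _; split; lra.
have := height_coef_const (fun k => (cl k).2); have := (cl 0).1; have := (cl 0).2; lra.
Qed.

Lemma mass_height_gt2 p k : 2 < height p -> mass p (Some k) = 0.
Proof.
move=> h2; apply/max_idPl; have := coef_low_le2 p k; lra.
Qed.

Lemma mass_continuous i : continuous (mass^~ i).
Proof.
case: i => [k|] p; last first.
  by apply: continuous_max; [exact: cst_continuous|exact: height_continuous].
have [t0|t0] := ypart_cases p.
  suff : {for p, continuous (mass^~ (Some k))} by [].
  apply: (@continuous_at_near_eq _ _ _ (fun=> 0)); last exact: cst_continuous.
  by move: (near_height_gt2 t0); apply: filterS => q /mass_height_gt2.
suff : {for p, continuous (fun q => Num.max 0 (coef q k - low q - height q))} by [].
apply: continuous_max; first exact: cst_continuous.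
apply: continuousB; last exact: height_continuous.
by apply: continuousB; [exact: coef_continuous|exact: low_continuous].
Qed.

Lemma site_continuous p i : 0 < mass p i -> {for p, continuous (site^~ i)}.
Proof.
case: i => [k|] mi; last first.
  have h0 : 0 < height p by move: mi; rewrite /= lt_max ltxx.
  apply: continuous_at_normalize; first exact: capped_sum_neq0.
  by move=> j; exact: capped_sum_continuous.
apply: continuous_at_normalize; first exact: frame_neq0.
move=> j; apply: frame_continuous; apply/eqP => t0.
by move: mi; rewrite mass_height_gt2 ?ltxx// height_ypart0//; lra.
Qed.

Lemma heightN p : height (antipode p) = height p.
Proof. by rewrite /height ypartN dotNl dotNr opprK. Qed.

Lemma coefN p k : ypart p != 0 -> coef (antipode p) k = coef p (swap_vertices n k).
Proof. by move=> t0; rewrite /coef xpartN frameN// dotNl dotNr opprK. Qed.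

Lemma lowN p : ypart p != 0 -> low (antipode p) = low p.
Proof.
move=> t0.
have le q : ypart q != 0 -> low (antipode q) <= low q.
  move=> q0; apply/bigmin_geP; split; first exact: bigmin_le_id.
  by move=> k _; rewrite -(@swap_verticesK n k) -coefN// low_le.
have t0' : ypart (antipode p) != 0 by rewrite ypartN oppr_eq0.
have leN := le _ t0'; rewrite antipodeK in leN.
exact: (le_anti (introT andP (conj (le p t0) leN))).
Qed.

Lemma levelN p k : ypart p != 0 -> level (antipode p) k = level p (swap_vertices n k).
Proof.
move=> t0; exact (f_equal2 Num.min
  (f_equal2 (fun a b => a - b) (coefN k t0) (lowN t0)) (heightN p)).
Qed.

Lemma capped_sumN p : 0 < height p -> capped_sum (antipode p) = - capped_sum p.
Proof.
move=> h0; have [t0|t0] := ypart_cases p.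
  have hp : 2 <= height p by rewrite (height_ypart0 t0); lra.
  have hN : 2 <= height (antipode p) by rewrite (heightN p).
  by rewrite (capped_sum_xpart hN) (capped_sum_xpart hp) xpartN scalerN.
rewrite -sumrN [LHS](reindex_inj (inv_inj (@swap_verticesK n))); apply: eq_bigr => k _.
rewrite -scalerN; congr (_ *: _).
  by have := levelN (swap_vertices n k) t0; rewrite swap_verticesK.
by have := frameN (swap_vertices n k) t0; rewrite swap_verticesK.
Qed.

Lemma mass_odd p i : mass (antipode p) i = mass p (swap i).
Proof.
case: i => [k|]; last exact (f_equal (Num.max 0) (heightN p)).
have [t0|t0] := ypart_cases p; last first.
  exact (f_equal (Num.max 0) (f_equal2 (fun a b => a - b)
    (f_equal2 (fun a b => a - b) (coefN k t0) (lowN t0)) (heightN p))).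
have hp : 2 < height p by rewrite (height_ypart0 t0); lra.
have hN : 2 < height (antipode p) by rewrite (heightN p).
transitivity (0 : R); first exact: mass_height_gt2.
by symmetry; exact: mass_height_gt2.
Qed.

Lemma site_odd p i : 0 < mass p i -> site (antipode p) (swap i) = antipode (site p i).
Proof.
case: i => [k|] mi; last first.
  have h0 : 0 < height p by move: mi; rewrite /= lt_max ltxx.
  transitivity (normalize (- capped_sum p)); last exact/normalizeN/capped_sum_neq0.
  by congr normalize; exact: capped_sumN.
have t0 : ypart p != 0.
  by apply/eqP => t0; move: mi; rewrite mass_height_gt2 ?ltxx// height_ypart0//; lra.
transitivity (normalize (- frame p k)); last exact/normalizeN/frame_neq0.
congr normalize; have := frameN (swap_vertices n k) t0; by rewrite swap_verticesK.
Qed.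

(** Two vertices are at distance r_n; a vertex with a mass and the direction of the
    capped sum are at distance at most pi/2. *)
Lemma site_geodesic p i j : 0 < mass p i -> 0 < mass p j ->
  geodesic (site p i) (site p j) <= r_ R n.
Proof.
have itv := @acos_simplex_itv R n; have /andP[itv1 itv2] := itv.
have neg : - 1 / n.+1%:R <= 0 :> R by rewrite mulN1r oppr_le0 invr_ge0.
move=> mi mj; rewrite geodesic_le ?acos_ge0 ?acos_lepi// acosK ?in_itv//.
have cross k : 0 < mass p (Some k) -> 0 < mass p None ->
    0 <= dot (frame p k) (normalize (capped_sum p)).
  rewrite /= !lt_max !ltxx /= subr_gt0 => hk h0.
  rewrite svec_normalize ?capped_sum_neq0// dotZr mulr_ge0 ?invr_ge0 ?sqrtr_ge0//.
  exact: dot_frame_capped_sum_ge0.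
case: i j mi mj => [k|] [l|] mi mj; rewrite /site.
- rewrite (normalize_frame p k) (normalize_frame p l) frame_dot.
  by case: (k == l); [exact: itv2|exact: lexx].
- rewrite (normalize_frame p k); exact: le_trans neg (cross _ mi mj).
- rewrite (normalize_frame p l) dotC; exact: le_trans neg (cross _ mj mi).
- rewrite svec_dot; exact: itv2.
Qed.

Lemma exists_odd_map_above r : r_ R n < r ->
  exists f : sphere R (n + 2) -> VR (sphere R n) r, odd_map f.
Proof.
move=> rr; apply: (odd_map_of_masses swapK rr mass_ge0 mass_ex mass_continuous
  site_continuous site_geodesic mass_odd site_odd).
Qed.

End SphereMap.

(** * The two thresholds *)

Section Equator.
Variables (R : realType) (k : nat).

Fact equator_subproof (x : sphere R k) : enorm (row_mx (0 : 'rV[R]_1) (svec x) : 'rV[R]_k.+2) == 1.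
Proof.
rewrite /enorm /dot (@big_split_ord _ _ _ 1 k.+1 xpredT
  (fun i => row_mx (0 : 'rV[R]_1) (svec x) 0 i * row_mx (0 : 'rV[R]_1) (svec x) 0 i))/=.
rewrite big_ord1 row_mxEl mxE mul0r add0r.
under eq_bigr do rewrite row_mxEr.
by rewrite -[X in Num.sqrt X]/(dot x x) svec_dot sqrtr1.
Qed.

Definition equator (x : sphere R k) : sphere R k.+1 := Sphere (equator_subproof x).

Lemma equatorN x : equator (antipode x) = antipode (equator x).
Proof.
apply/val_inj/rowP => i; rewrite /= !mxE.
by case: (@fintype.split 1 k.+1 i) => j; rewrite !mxE ?oppr0.
Qed.

Lemma equator_continuous : continuous equator.
Proof.
move=> x; apply: sphere_continuous_at => i.
case: (@fintype.splitP 1 k.+1 i) => j ij.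
  rewrite (_ : (fun y => _) = fun=> 0); first exact: cst_continuous.
  apply/funext => y /=; rewrite (_ : i = lshift k.+1 j); last exact/val_inj.
  by have := row_mxEl (0 : 'rV[R]_1) (svec y) 0 j; rewrite [in X in _ = X]mxE.
rewrite (_ : (fun y => _) = fun y => svec y 0 j); first exact: svec_continuous.
apply/funext => y /=; rewrite (_ : i = rshift 1 j); last exact/val_inj.
exact: row_mxEr.
Qed.

Lemma odd_map_equator n (r : R) (f : sphere R k.+1 -> VR (sphere R n) r) :
  odd_map f -> odd_map (f \o equator).
Proof.
move=> [fc fodd]; split; last by move=> x /=; rewrite equatorN fodd.
by move=> x; apply: continuous_comp; [exact: equator_continuous|exact: fc].
Qed.

End Equator.

Lemma inf_threshold (R : realType) (A : set R) (b : R) :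
  (forall r, A r -> b <= r) -> (forall r, b < r -> A r) -> inf A = b.
Proof.
move=> lbA gtA; apply/eqP; rewrite eq_le; apply/andP; split.
  apply/ler_addgt0Pr => e e0; apply: ge_inf; first by exists b.
  by apply: gtA; rewrite ltrDl.
by apply: lb_le_inf => //; exists (b + 1); apply: gtA; rewrite ltrDl.
Qed.

Theorem theorem5p2 (R : realType) (n : nat) (n_ge1 : (1 <= n)%N) :
  c_ R n (n + 2) = c_ R n (n + 1) /\ c_ R n (n + 1) = r_ R n.
Proof.
have rn0 : 0 <= r_ R n by rewrite acos_ge0 ?acos_simplex_itv.
have below r : 0 <= r -> (exists f : sphere R n.+1 -> VR (sphere R n) r, odd_map f) ->
    r_ R n <= r.
  by move=> r0 [f fodd]; rewrite leNgt; apply/negP => /(no_odd_map_below r0)/(_ fodd).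
have above r : r_ R n < r -> 0 <= r /\
    exists f : sphere R n.+2 -> VR (sphere R n) r, odd_map f.
  by move=> /[dup] /(le_lt_trans rn0)/ltW r0 /exists_odd_map_above; rewrite addn2.
have c1 : c_ R n (n + 1) = r_ R n.
  rewrite addn1; apply: inf_threshold => [r [r0]|r /above[r0 [f fodd]]]; first exact: below.
  by split => //; exists (f \o @equator R n.+1); exact: odd_map_equator.
split=> //; rewrite c1 addn2; apply: inf_threshold => // r [r0 [f fodd]].
by apply: below => //; exists (f \o @equator R n.+1); exact: odd_map_equator.
Qed.
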